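(* Let $\rho\in\mathbb R$, let $\mathbf a=(a_{m,n})_{m,n=1}^\infty$ be a matrix with complex entries, and let $\kappa_{\mathbf a}:\mathbb H_\rho\times\mathbb H_\rho\to\mathbb C$ be the Dirichlet series kernel with coefficient matrix $\mathbf a$. Then the following statements are equivalent: (i) $\kappa_{\mathbf a}$ is $\mathrm{Aut}(\mathbb H_\rho)$-quasi-invariant with respect to some $\mathcal J$; (ii) $\kappa_{\mathbf a}$ is $\mathrm{Aut}_L(\mathbb H_\rho)$-quasi-invariant with respect to some $\mathcal J$; (iii) there exists a Dirichlet series $f:\mathbb H_\rho\to\mathbb C$ (convergent at every point of $\mathbb H_\rho$) such that $\kappa_{\mathbf a}(s,u)=f(s)\overline{f(u)}$ for all $s,u\in\mathbb H_\rho$, where $f$ is either identically zero or nowhere-vanishing on $\mathbb H_\rho$; (iv) $\kappa_{\mathbf a}$ is positive semi-definite and the reproducing kernel Hilbert space $\mathscr H_{\mathbf a}$ associated with $\kappa_{\mathbf a}$ is either $\{0\}$ or is spanned by a single nowhere-vanishing Dirichlet series on $\mathbb H_\rho$.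
   Context: For $\rho\in\mathbb R$, $\mathbb H_\rho=\{s\in\mathbb C:\Re(s)>\rho\}$. A double Dirichlet series $\sum_{m,n\ge1}c_{m,n}m^{-s}n^{-u}$ is regularly convergent at $(s_0,u_0)\in\mathbb C^2$ if the double series converges at $(s_0,u_0)$ and, for all integers $m,n\ge1$, the series $\sum_{m\ge1}c_{m,n}m^{-s_0}$ and $\sum_{n\ge1}c_{m,n}n^{-u_0}$ converge; it is regularly convergent on $\mathbb H_\rho\times\mathbb H_\rho$ if it is so at every point. For a complex matrix $\mathbf a=(a_{m,n})$, $\kappa_{\mathbf a}(s,u)=\sum_{m,n\ge1}a_{m,n}m^{-s}n^{-\bar u}$ is called a Dirichlet series kernel on $\mathbb H_\rho$ (with coefficient matrix $\mathbf a$) if the double Dirichlet series $(s,u)\mapsto\kappa_{\mathbf a}(s,\bar u)$ is regularly convergent on $\mathbb H_\rho\times\mathbb H_\rho$. A kernel $\kappa$ on a set $X$ is positive semi-definite if $(\kappa(x_i,x_j))_{i,j=1}^N$ is positive semi-definite for all finite $x_1,\dots,x_N\in X$. If $\kappa_{\mathbf a}$ is positive semi-definite, $\mathscr H_{\mathbf a}$ denotes the unique Hilbert space of functions on $\mathbb H_\rho$ containing $\kappa_{\mathbf a}(\cdot,t)$ for all $t\in\mathbb H_\rho$ with $\langle f,\kappa_{\mathbf a}(\cdot,t)\rangle=f(t)$ for all $f\in\mathscr H_{\mathbf a}$. For $A=\begin{pmatrix}a&b\\c&d\end{pmatrix}\in\mathrm{SL}_2(\mathbb R)$ let $\phi_A(s)=\frac{a(s-\rho)-ib}{ic(s-\rho)+d}+\rho$;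 then $\mathrm{Aut}(\mathbb H_\rho)=\{\phi_A:A\in\mathrm{SL}_2(\mathbb R)\}$ is the group of biholomorphic self-maps of $\mathbb H_\rho$, and $\mathrm{Aut}_L(\mathbb H_\rho)=\{\phi_A: A\in\mathrm{SL}_2(\mathbb R),\ c=0\}$. Quasi-invariance: Let $G$ be a group acting on a domain $\Omega$, let $\mathcal J:G\times\Omega\to\mathbb C$ be nowhere-vanishing with $\mathcal J(g,\cdot)$ holomorphic for each $g\in G$, and let $\kappa:\Omega\times\Omega\to\mathbb C$ be a positive semi-definite kernel. Then $\kappa$ is $G$-quasi-invariant with respect to $\mathcal J$ if $\mathcal J(g,s)\kappa(g\cdot s,g\cdot u)\overline{\mathcal J(g,u)}=\kappa(s,u)$ for all $s,u\in\Omega$, $g\in G$. *)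

(* Defs.v *)
From Stdlib Require Import Reals.
From Coquelicot Require Import Coquelicot.
Open Scope R_scope.

Definition cexp (z : C) : C :=
  (exp (Re z) * cos (Im z), exp (Re z) * sin (Im z)).

Definition npow_neg (m : nat) (s : C) : C :=
  cexp (Copp (Cmult s (RtoC (ln (INR m))))).

Definition inH (rho : R) (s : C) : Prop := rho < Re s.
Definition Hr (rho : R) : Type := {s : C | rho < Re s}.

Definition dir_term (b : nat -> C) (s : C) (k : nat) : C :=
  Cmult (b (S k)) (npow_neg (S k) s).

Definition DirichletOn (rho : R) (b : nat -> C) (f : C -> C) : Prop :=
  forall s, inH rho s -> is_series (dir_term b s) (f s).

Definition dterm (c : nat -> nat -> C) (s u : C) (i j : nat) : C :=
  Cmult (Cmult (c (S i) (S j)) (npow_neg (S i) s)) (npow_neg (S j) u).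

Definition dpsum (c : nat -> nat -> C) (s u : C) (M N : nat) : C :=
  sum_n (fun i => sum_n (fun j => dterm c s u i j) N) M.

(* convergence of the double series (Pringsheim: rectangular partial sums
   converge as M, N -> oo jointly) *)
Definition dconv_to (c : nat -> nat -> C) (s u : C) (l : C) : Prop :=
  filterlim (fun p : nat * nat => dpsum c s u (fst p) (snd p))
    (filter_prod eventually eventually) (locally l).

Definition dconv (c : nat -> nat -> C) (s u : C) : Prop :=
  exists l : C, dconv_to c s u l.

Definition dsum (c : nat -> nat -> C) (s u : C) : C :=
  @lim C_CompleteNormedModule (filtermap (fun p : nat * nat => dpsum c s u (fst p) (snd p))
         (filter_prod eventually eventually)).

Definition reg_conv_at (c : nat -> nat -> C) (s0 u0 : C) : Prop :=
  dconv c s0 u0 /\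
  (forall m : nat, (1 <= m)%nat ->
      ex_series (fun j => Cmult (c m (S j)) (npow_neg (S j) u0))) /\
  (forall n : nat, (1 <= n)%nat ->
      ex_series (fun i => Cmult (c (S i) n) (npow_neg (S i) s0))).

Definition kappa (a : nat -> nat -> C) (s u : C) : C := dsum a s (Cconj u).

(* kappa_a is a Dirichlet series kernel on H_rho:
   (s,u) |-> kappa_a(s, conj u) is regularly convergent on H_rho x H_rho *)
Definition DirichletKernel (rho : R) (a : nat -> nat -> C) : Prop :=
  forall s u, inH rho s -> inH rho u -> reg_conv_at a s u.

Definition quad_form (k : C -> C -> C) (N : nat) (x : nat -> C) (c : nat -> C) : C :=
  sum_n (fun i => sum_n (fun j =>
     Cmult (Cmult (Cconj (c i)) (k (x i) (x j))) (c j)) N) N.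

Definition PSD_on (rho : R) (k : C -> C -> C) : Prop :=
  forall (N : nat) (x : nat -> C), (forall i, (i <= N)%nat -> inH rho (x i)) ->
    forall c : nat -> C,
      Im (quad_form k N x c) = 0 /\ 0 <= Re (quad_form k N x c).

Definition phiA (rho a b c d : R) (s : C) : C :=
  Cplus (Cdiv (Cminus (Cmult (RtoC a) (Cminus s (RtoC rho))) (Cmult Ci (RtoC b)))
              (Cplus (Cmult (Cmult Ci (RtoC c)) (Cminus s (RtoC rho))) (RtoC d)))
        (RtoC rho).

Definition AutH (rho : R) (g : C -> C) : Prop :=
  exists a b c d : R, a * d - b * c = 1 /\ g = phiA rho a b c d.

Definition AutLH (rho : R) (g : C -> C) : Prop :=
  exists a b d : R, a * d - b * 0 = 1 /\ g = phiA rho a b 0 d.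

Definition holo_on (rho : R) (f : C -> C) : Prop :=
  forall s, inH rho s -> exists l : C, @is_derive C_AbsRing C_NormedModule f s l.

(* As in the paper, the notion presupposes k positive semi-definite.   *)
Definition QuasiInvariant (rho : R) (G : (C -> C) -> Prop)
    (J : (C -> C) -> C -> C) (k : C -> C -> C) : Prop :=
  PSD_on rho k /\
  (forall g, G g -> (forall s, inH rho s -> J g s <> RtoC 0) /\ holo_on rho (J g)) /\
  (forall g s u, G g -> inH rho s -> inH rho u ->
     Cmult (Cmult (J g s) (k (g s) (g u))) (Cconj (J g u)) = k s u).

Definition fzero (rho : R) : Hr rho -> C := fun _ => RtoC 0.
Definition fadd (rho : R) (f g : Hr rho -> C) : Hr rho -> C := fun x => Cplus (f x) (g x).
Definition fscal (rho : R) (c : C) (f : Hr rho -> C) : Hr rho -> C := fun x => Cmult c (f x).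
Definition fsub (rho : R) (f g : Hr rho -> C) : Hr rho -> C := fun x => Cminus (f x) (g x).

Definition IsRKHS (rho : R) (k : C -> C -> C)
    (V : (Hr rho -> C) -> Prop) (ip : (Hr rho -> C) -> (Hr rho -> C) -> C) : Prop :=
  let nrm := fun f => sqrt (Re (ip f f)) in
  V (fzero rho) /\
  (forall f g, V f -> V g -> V (fadd rho f g)) /\
  (forall c f, V f -> V (fscal rho c f)) /\
  (forall f g h, V f -> V g -> V h -> ip (fadd rho f g) h = Cplus (ip f h) (ip g h)) /\
  (forall c f g, V f -> V g -> ip (fscal rho c f) g = Cmult c (ip f g)) /\
  (forall f g, V f -> V g -> ip g f = Cconj (ip f g)) /\
  (forall f, V f -> 0 <= Re (ip f f)) /\
  (forall f, V f -> ip f f = RtoC 0 -> f = fzero rho) /\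
  (forall u : nat -> (Hr rho -> C), (forall n, V (u n)) ->
     (forall eps, 0 < eps -> exists N, forall m n, (N <= m)%nat -> (N <= n)%nat ->
        nrm (fsub rho (u m) (u n)) < eps) ->
     exists f, V f /\ forall eps, 0 < eps -> exists N, forall n, (N <= n)%nat ->
        nrm (fsub rho (u n) f) < eps) /\
  (forall t : Hr rho, V (fun x => k (proj1_sig x) (proj1_sig t))) /\
  (forall f (t : Hr rho), V f -> ip f (fun x => k (proj1_sig x) (proj1_sig t)) = f t).

(* Main.v *)
(* Dilating towards [Re = +oo] turns a Dirichlet series kernel into its leading term
   [c_nn (n+1)^(-s) (n+1)^(-conj u)], where [c_nn] exists by Cauchy-Schwarz unless the kernel vanishes.
   Hence a kernel quasi-invariant under dilations is a limit of rank-one kernels, so it satisfies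
   [k(s,u) k(t,t) = k(s,t) k(t,u)] and [f = k(.,t) / sqrt k(t,t)] works; transitivity of the affine
   action makes [f] zero everywhere or nowhere.  Conversely [J(g,s) = f(s) / f(g s)], holomorphic by Abel summation.
   For (iv) the Hilbert space is built as the pointwise limits of Cauchy sequences of kernel
   combinations. *)

(* Regular convergence may be only conditional, so no double sum here can be estimated term by term.
   What replaces absolute convergence is a uniform bound on all rectangular partial sums at the base
   point [rho + 1], together with Abel summation in each variable. Convergence of the single rows
   and columns enters exactly in that bound. Abel summation against [(n+1)^(-z)] costs a factor
   [|z| / Re z], which is why the limit is taken along dilations, where this factor stays bounded.
   The identity [k(s,u) k(t,t) = k(s,t) k(t,u)] is chosen because each point occurs equally often in
   each argument on both sides: the unknown multiplier and the leading powers cancel, and only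
   quotients tending to [c_nn] remain. Statement (iv) speaks of every Hilbert space with the
   reproducing property, so it says something about the kernel only once one such space is
   exhibited; hence the explicit construction. *)
Require Import Defs.
From Stdlib Require Import Reals Lra Lia Arith List ClassicalEpsilon FunctionalExtensionality.
From Coquelicot Require Import Coquelicot.
Open Scope R_scope.

(** * Limits and the exponential in C *)

Lemma Clim_eps {T : Type} {F : (T -> Prop) -> Prop} {FF : Filter F} (f : T -> C) (l : C) :
  filterlim f F (locally l) <-> (forall eps : R, 0 < eps -> F (fun x => Cmod (f x - l) < eps)).
Proof.
  split.
  - intros H eps He.
    exact (proj1 (filterlim_locally_ball_norm (K := C_AbsRing) (U := C_NormedModule) f l) H
             (mkposreal eps He)).
  - intros H.
    apply (proj2 (filterlim_locally_ball_norm (K := C_AbsRing) (U := C_NormedModule) f l)).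
    intros eps. exact (H eps (cond_pos eps)).
Qed.

Lemma Clim_squeeze {T : Type} {F : (T -> Prop) -> Prop} {FF : Filter F}
    (f : T -> C) (g : T -> R) (l : C) :
  F (fun x => Cmod (f x - l) <= g x) -> filterlim g F (locally 0) ->
  filterlim f F (locally l).
Proof.
  intros H1 H2. apply Clim_eps. intros eps He.
  pose proof (proj1 (filterlim_locally g 0) H2 (mkposreal eps He)) as H3.
  generalize (filter_and _ _ H1 H3). apply filter_imp. intros x [Ha Hb].
  unfold ball in Hb; simpl in Hb; unfold AbsRing_ball, abs, minus, plus, opp in Hb; simpl in Hb.
  apply Rabs_def2 in Hb. lra.
Qed.

Lemma Clim_plus {T : Type} {F : (T -> Prop) -> Prop} {FF : Filter F} (f g : T -> C) (l m : C) :
  filterlim f F (locally l) -> filterlim g F (locally m) ->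
  filterlim (fun x => f x + g x)%C F (locally (l + m)%C).
Proof.
  intros Hf Hg.
  exact (filterlim_comp_2 _ _ _ Hf Hg (filterlim_plus (V := C_NormedModule) l m)).
Qed.

Lemma Clim_mult {T : Type} {F : (T -> Prop) -> Prop} {FF : Filter F} (f g : T -> C) (l m : C) :
  filterlim f F (locally l) -> filterlim g F (locally m) ->
  filterlim (fun x => f x * g x)%C F (locally (l * m)%C).
Proof.
  intros Hf Hg.
  (* [filterlim_scal] takes its scalar in the uniform structure of the absolute ring; [locally_C]
     identifies its neighbourhoods with those of the normed module. *)
  assert (Hf' : filterlim f F (locally (T := AbsRing_UniformSpace C_AbsRing) l)).
  { intros P HP. apply Hf. apply locally_C. exact HP. }
  exact (filterlim_comp_2 _ _ _ Hf' Hg (filterlim_scal (V := C_NormedModule) (l : C_AbsRing) m)).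
Qed.

Lemma Clim_opp {T : Type} {F : (T -> Prop) -> Prop} {FF : Filter F} (f : T -> C) (l : C) :
  filterlim f F (locally l) -> filterlim (fun x => - f x)%C F (locally (- l)%C).
Proof.
  intros Hf.
  exact (filterlim_comp _ _ _ _ _ _ _ _ Hf (filterlim_opp (V := C_NormedModule) l)).
Qed.

Lemma Clim_minus {T : Type} {F : (T -> Prop) -> Prop} {FF : Filter F} (f g : T -> C) (l m : C) :
  filterlim f F (locally l) -> filterlim g F (locally m) ->
  filterlim (fun x => f x - g x)%C F (locally (l - m)%C).
Proof. intros Hf Hg. apply Clim_plus; [exact Hf | now apply Clim_opp]. Qed.

Lemma Clim_const {T : Type} {F : (T -> Prop) -> Prop} {FF : Filter F} (l : C) :
  filterlim (fun _ : T => l) F (locally l).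
Proof. apply filterlim_const. Qed.

Lemma Clim_conj {T : Type} {F : (T -> Prop) -> Prop} {FF : Filter F} (f : T -> C) (l : C) :
  filterlim f F (locally l) -> filterlim (fun x => Cconj (f x)) F (locally (Cconj l)).
Proof.
  intros H. apply Clim_eps. intros eps He.
  generalize (proj1 (Clim_eps f l) H eps He). apply filter_imp.
  intros x Hx. now rewrite <- Cminus_conj, Cmod_conj.
Qed.

Lemma Clim_Re {T : Type} {F : (T -> Prop) -> Prop} {FF : Filter F} (f : T -> C) (l : C) :
  filterlim f F (locally l) -> filterlim (fun x => Re (f x)) F (locally (Re l)).
Proof.
  intros H P [eps HP].
  change (F (fun x => P (Re (f x)))).
  generalize (proj1 (Clim_eps f l) H eps (cond_pos eps)). apply filter_imp.
  intros x Hx. apply HP.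
  eapply Rle_lt_trans; [apply (re_le_Cmod (f x - l)) | exact Hx].
Qed.

Lemma Clim_unique {T : Type} {F : (T -> Prop) -> Prop} {FF : ProperFilter F}
    (f : T -> C) (l m : C) :
  filterlim f F (locally l) -> filterlim f F (locally m) -> l = m.
Proof.
  intros H1 H2.
  exact (filterlim_locally_unique (V := C_NormedModule) f l m H1 H2).
Qed.

Lemma Clim_Cmod_le {T : Type} {F : (T -> Prop) -> Prop} {FF : ProperFilter F}
    (f : T -> C) (l : C) (B : R) :
  filterlim f F (locally l) -> F (fun x => Cmod (f x) <= B) -> Cmod l <= B.
Proof.
  intros H HB.
  apply Rnot_lt_le; intros Hlt.
  pose proof (proj1 (Clim_eps f l) H (Cmod l - B) ltac:(lra)) as H1.
  destruct (filter_ex _ (filter_and _ _ HB H1)) as [x [Ha Hb]].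
  pose proof (Cmod_triangle (f x) (- (f x - l))) as H2.
  rewrite Cmod_opp in H2. replace (f x + - (f x - l))%C with l in H2 by ring.
  lra.
Qed.

Lemma Cmod_sqr_conj (z : C) : (z * Cconj z)%C = RtoC (Cmod z ^ 2).
Proof. rewrite <- Cmod2_conj. now rewrite RtoC_pow. Qed.

Lemma cexp_plus (z w : C) : cexp (z + w) = (cexp z * cexp w)%C.
Proof.
  destruct z as [a b], w as [c d]. unfold cexp, Cmult, Cplus; simpl.
  rewrite exp_plus, cos_plus, sin_plus. f_equal; ring.
Qed.

Lemma Cmod_cexp (z : C) : Cmod (cexp z) = exp (Re z).
Proof.
  unfold cexp, Cmod; simpl fst; simpl snd.
  replace (_ + _) with (exp (Re z) ^ 2 * (Rsqr (sin (Im z)) + Rsqr (cos (Im z)))) by (unfold Rsqr; ring).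
  rewrite sin2_cos2, Rmult_1_r. apply sqrt_pow2. left; apply exp_pos.
Qed.

Lemma cexp_0 : cexp 0 = 1.
Proof. unfold cexp; simpl. rewrite exp_0, cos_0, sin_0. unfold RtoC. f_equal; ring. Qed.

Lemma cexp_RtoC (r : R) : cexp (RtoC r) = RtoC (exp r).
Proof. unfold cexp; simpl. rewrite cos_0, sin_0. unfold RtoC. f_equal; ring. Qed.

(* Projecting on the direction of [G p - G q] reduces to a monotone real function. *)
Lemma Cmod_increment_le (G dG : R -> C) (h dh : R -> R) (p q : R) :
  p <= q ->
  (forall t, p <= t <= q -> is_derive (fun t => Re (G t)) t (Re (dG t))) ->
  (forall t, p <= t <= q -> is_derive (fun t => Im (G t)) t (Im (dG t))) ->
  (forall t, p <= t <= q -> is_derive h t (dh t)) ->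
  (forall t, p <= t <= q -> Cmod (dG t) <= - dh t) ->
  Cmod (G p - G q) <= h p - h q.
Proof.
  intros Hpq HR HI Hh Hb.
  set (w := (G p - G q)%C).
  set (phi := fun t => Re w * Re (G t) + Im w * Im (G t) - Cmod w * h t).
  assert (Hd : forall t, p <= t <= q ->
     is_derive phi t (Re w * Re (dG t) + Im w * Im (dG t) - Cmod w * dh t)).
  { intros t Ht. unfold phi.
    apply (is_derive_minus (K := R_AbsRing) (V := R_NormedModule)).
    apply (is_derive_plus (K := R_AbsRing) (V := R_NormedModule)).
    - apply (is_derive_scal (fun t => Re (G t))); auto.
    - apply (is_derive_scal (fun t => Im (G t))); auto.
    - apply (is_derive_scal h); auto. }
  assert (Hpos : forall t, p <= t <= q ->
     0 <= Re w * Re (dG t) + Im w * Im (dG t) - Cmod w * dh t).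
  { intros t Ht.
    pose proof (re_le_Cmod (Cconj w * dG t)) as H1.
    rewrite Cmod_mult, Cmod_conj in H1.
    replace (Re (Cconj w * dG t)) with (Re w * Re (dG t) + Im w * Im (dG t)) in H1
      by (destruct w, (dG t); simpl; ring).
    pose proof (Hb t Ht) as H2.
    pose proof (Rmult_le_compat_l _ _ _ (Cmod_ge_0 w) H2) as H3.
    apply Rabs_le_between in H1. lra. }
  assert (Hmon : phi p <= phi q).
  { destruct (MVT_gen phi p q (fun t => Re w * Re (dG t) + Im w * Im (dG t) - Cmod w * dh t))
      as [c [Hc Heq]].
    - intros t. rewrite Rmin_left, Rmax_right by lra. intros Ht. apply Hd; lra.
    - intros t. rewrite Rmin_left, Rmax_right by lra. intros Ht.
      apply continuity_pt_filterlim, (ex_derive_continuous (V := R_NormedModule)).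
      eexists; apply Hd; lra.
    - rewrite Rmin_left, Rmax_right in Hc by lra.
      pose proof (Hpos c Hc). nra. }
  unfold phi in Hmon.
  assert (Hw : Cmod w ^ 2 <= Cmod w * (h p - h q)).
  { rewrite Cmod2_alt.
    replace (Re w ^ 2 + Im w ^ 2) with (Re w * (Re (G p) - Re (G q)) + Im w * (Im (G p) - Im (G q)))
      by (unfold w, Re, Im, Cminus, Cplus, Copp; simpl; ring).
    lra. }
  destruct (Rle_lt_or_eq_dec _ _ (Cmod_ge_0 w)) as [Hlt | Heq].
  - apply Rmult_le_reg_l with (Cmod w); [exact Hlt |]. lra.
  (* No division by [Cmod w] is possible here. The claim becomes [h q <= h p], and [h] decreases
     because [dh <= - Cmod dG <= 0]. *)
  - rewrite <- Heq.
    assert (h q <= h p); [|lra].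
    destruct (MVT_gen h p q dh) as [c [Hc Hc']].
    + intros t. rewrite Rmin_left, Rmax_right by lra. intros Ht. apply Hh; lra.
    + intros t. rewrite Rmin_left, Rmax_right by lra. intros Ht.
      apply continuity_pt_filterlim, (ex_derive_continuous (V := R_NormedModule)).
      eexists; apply Hh; lra.
    + rewrite Rmin_left, Rmax_right in Hc by lra.
      pose proof (Hb c Hc). pose proof (Cmod_ge_0 (dG c)). nra.
Qed.

Lemma cexp_line_derive (z : C) (t : R) :
  is_derive (fun t => Re (cexp (z * RtoC t))) t (Re (z * cexp (z * RtoC t))) /\
  is_derive (fun t => Im (cexp (z * RtoC t))) t (Im (z * cexp (z * RtoC t))).
Proof.
  assert (H : forall t, (z * RtoC t)%C = (Re z * t, Im z * t)).
  { intros u. destruct z. unfold Cmult, RtoC; simpl. f_equal; ring. }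
  rewrite H. split.
  - apply (is_derive_ext (fun t => exp (Re z * t) * cos (Im z * t))).
    { intros u. now rewrite H. }
    destruct z as [x y]; unfold cexp, Cmult; simpl. auto_derive; [exact I | ring].
  - apply (is_derive_ext (fun t => exp (Re z * t) * sin (Im z * t))).
    { intros u. now rewrite H. }
    destruct z as [x y]; unfold cexp, Cmult; simpl. auto_derive; [exact I | ring].
Qed.

(** * Abel summation *)

(** Pinning one monoid structure on C lets the rewriting lemmas match everywhere; sums stated
    through other canonical structures are convertible to it. *)
Definition Csum (a : nat -> C) (n : nat) : C := @sum_n C_AbelianMonoid a n.

Lemma Csum_S (a : nat -> C) (n : nat) : Csum a (S n) = (Csum a n + a (S n))%C.
Proof. exact (sum_Sn (G := C_AbelianMonoid) a n). Qed.

Lemma Csum_0 (a : nat -> C) : Csum a 0 = a 0%nat.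
Proof. exact (sum_O (G := C_AbelianMonoid) a). Qed.

Lemma Csum_eq (a b : nat -> C) (n : nat) :
  (forall i, (i <= n)%nat -> a i = b i) -> Csum a n = Csum b n.
Proof. exact (sum_n_ext_loc (G := C_AbelianMonoid) a b n). Qed.

Lemma Csum_zero (a : nat -> C) (n : nat) :
  (forall i, (i <= n)%nat -> a i = 0) -> Csum a n = RtoC 0.
Proof.
  induction n as [|n IH]; intros H.
  - rewrite Csum_0. now apply H.
  - rewrite Csum_S, IH, H by auto. ring.
Qed.

Lemma Csum_mult_l (x : C) (a : nat -> C) (n : nat) :
  Csum (fun i => x * a i)%C n = (x * Csum a n)%C.
Proof. exact (sum_n_mult_l (K := C_Ring) x a n). Qed.

Lemma Csum_mult_r (x : C) (a : nat -> C) (n : nat) :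
  Csum (fun i => a i * x)%C n = (Csum a n * x)%C.
Proof. exact (sum_n_mult_r (K := C_Ring) x a n). Qed.

Lemma Csum_minus (a b : nat -> C) (n : nat) :
  Csum (fun i => a i - b i)%C n = (Csum a n - Csum b n)%C.
Proof.
  induction n as [|n IH].
  - now rewrite !Csum_0.
  - rewrite !Csum_S, IH. ring.
Qed.

Lemma Csum_switch (a : nat -> nat -> C) (m n : nat) :
  Csum (fun i => Csum (a i) n) m = Csum (fun j => Csum (fun i => a i j) m) n.
Proof. exact (sum_n_switch (G := C_AbelianMonoid) a m n). Qed.

Lemma Csum_single (x : C) (n m : nat) : (n <= m)%nat ->
  Csum (fun i => if Nat.eq_dec i n then x else RtoC 0) m = x.
Proof.
  induction m as [|m IH]; intros H.
  - rewrite Csum_0. destruct (Nat.eq_dec 0 n); [reflexivity | lia].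
  - rewrite Csum_S. destruct (Nat.eq_dec (S m) n) as [E|E].
    + rewrite Csum_zero; [ring |]. intros i Hi. destruct (Nat.eq_dec i n); [lia | reflexivity].
    + rewrite IH by lia. ring.
Qed.

(** The form of bounded variation that Abel summation needs: increments telescope against [e], so
    the variation of [G] from [n] to [M] is at most [e n - e M]. In particular [e] is nonnegative
    and nonincreasing. *)
Definition dominated_by (G : nat -> C) (e : nat -> R) : Prop :=
  (forall i, Cmod (G i) <= e i) /\ (forall i, Cmod (G i - G (S i)) <= e i - e (S i)).

(** Summation by parts: the increments of [G] contribute at most [B (e n - e M)] and the boundary
    term at most [B e M]. Vanishing of [c] below [n] is what produces [e n] instead of [e 0]. *)
Lemma abel_bound (c G : nat -> C) (e : nat -> R) (B : R) (n M : nat) :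
  (forall m, Cmod (Csum c m) <= B) -> (forall i, (i < n)%nat -> c i = 0) ->
  dominated_by G e -> Cmod (Csum (fun i => c i * G i)%C M) <= B * e n.
Proof.
  intros HB Hc [H1 H2].
  assert (B0 : 0 <= B) by (eapply Rle_trans; [apply Cmod_ge_0 | apply (HB 0%nat)]).
  assert (e0 : forall i, 0 <= e i) by (intros i; eapply Rle_trans; [apply Cmod_ge_0 | apply H1]).
  destruct (le_lt_dec n M) as [HM | HM].
  2: { rewrite Csum_zero. rewrite Cmod_0. now apply Rmult_le_pos.
       intros i Hi. rewrite Hc by lia. ring. }
  (* With the boundary term subtracted, the estimate telescopes and is stable under induction on
     [M]. *)
  assert (K : Cmod (Csum (fun i => c i * G i)%C M - Csum c M * G M) <= B * (e n - e M)).
  { induction HM as [|M HM IH].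
    - assert (E : Csum (fun i => c i * G i)%C n = (Csum c n * G n)%C).
      { destruct n as [|n].
        - now rewrite !Csum_0.
        - rewrite !Csum_S, !Csum_zero. ring.
          intros i Hi. apply Hc; lia.
          intros i Hi. rewrite Hc by lia. ring. }
      rewrite E. unfold Cminus. rewrite Cplus_opp_r, Cmod_0. lra.
    - rewrite !Csum_S.
      replace (_ - _)%C with ((Csum (fun i => c i * G i)%C M - Csum c M * G M)
          + Csum c M * (G M - G (S M)))%C by ring.
      eapply Rle_trans; [apply Cmod_triangle |].
      rewrite Cmod_mult.
      pose proof (Rmult_le_compat _ _ _ _ (Cmod_ge_0 _) (Cmod_ge_0 _) (HB M) (H2 M)). lra. }
  replace (Csum (fun i => c i * G i)%C M)
    with ((Csum (fun i => c i * G i)%C M - Csum c M * G M) + Csum c M * G M)%C by ring.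
  eapply Rle_trans; [apply Cmod_triangle |].
  rewrite Cmod_mult.
  pose proof (Rmult_le_compat _ _ _ _ (Cmod_ge_0 _) (Cmod_ge_0 _) (HB M) (H1 M)). lra.
Qed.

(** Deleting the entry [c n] leaves a sequence that starts at [S n]. Its partial sums are those of
    [c] minus [c n], and [c n] is itself the partial sum at [n], hence the bound [2 B]. *)
Lemma abel_leading (c G : nat -> C) (e : nat -> R) (B : R) (n M : nat) :
  (forall m, Cmod (Csum c m) <= B) -> (forall i, (i < n)%nat -> c i = 0) ->
  dominated_by G e -> (n <= M)%nat ->
  Cmod (Csum (fun i => c i * G i)%C M - c n * G n) <= 2 * B * e (S n).
Proof.
  intros HB Hc HG HM.
  set (d := fun i => if Nat.eq_dec i n then RtoC 0 else c i).
  assert (Hcd : forall i, d i = (c i - if Nat.eq_dec i n then c n else RtoC 0)%C).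
  { intros i. unfold d. destruct (Nat.eq_dec i n) as [->|]; ring. }
  assert (HS : forall m, (n <= m)%nat -> Csum d m = (Csum c m - c n)%C).
  { intros m Hm. rewrite (Csum_eq d _ m (fun i _ => Hcd i)), Csum_minus, Csum_single by lia.
    reflexivity. }
  assert (Hn : Csum c n = c n).
  { destruct n as [|n].
    - apply Csum_0.
    - rewrite Csum_S, Csum_zero by (intros i Hi; apply Hc; lia). ring. }
  assert (HdB : forall m, Cmod (Csum d m) <= 2 * B).
  { intros m. destruct (le_lt_dec n m) as [Hm | Hm].
    - rewrite HS by lia. eapply Rle_trans; [apply Cmod_triangle |].
      rewrite Cmod_opp. pose proof (HB m). pose proof (HB n). rewrite Hn in *. lra.
    - rewrite Csum_zero. rewrite Cmod_0. pose proof (HB 0%nat).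
      pose proof (Cmod_ge_0 (Csum c 0)). lra.
      intros i Hi. unfold d. destruct (Nat.eq_dec i n); [reflexivity | apply Hc; lia]. }
  assert (Hd0 : forall i, (i < S n)%nat -> d i = 0).
  { intros i Hi. unfold d. destruct (Nat.eq_dec i n); [reflexivity | apply Hc; lia]. }
  replace (Csum (fun i => c i * G i)%C M - c n * G n)%C with (Csum (fun i => d i * G i)%C M).
  - apply abel_bound; assumption.
  - rewrite (Csum_eq _ (fun i => c i * G i - (if Nat.eq_dec i n then c n * G n else RtoC 0))%C).
    + rewrite Csum_minus, Csum_single by lia. reflexivity.
    + intros i _. rewrite Hcd. destruct (Nat.eq_dec i n) as [->|]; ring.
Qed.

Definition logn (i : nat) : R := ln (INR (S i)).

Lemma logn_ge_0 (i : nat) : 0 <= logn i.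
Proof.
  unfold logn. rewrite <- ln_1. apply Rcomplements.ln_le; [lra |].
  rewrite S_INR. pose proof (pos_INR i). lra.
Qed.

Lemma logn_lt (i : nat) : logn i < logn (S i).
Proof. unfold logn. apply ln_increasing; [apply lt_0_INR; lia | apply lt_INR; lia]. Qed.

(** Sampling at the points [logn i]: the bound on [dG] is minus the derivative of [K exp (- y t)],
    so each increment of [G] is at most the corresponding decrease of that exponential. *)
Lemma dominated_of_derive (G dG : R -> C) (K y : R) :
  0 < y ->
  (forall t, 0 <= t -> is_derive (fun t => Re (G t)) t (Re (dG t))) ->
  (forall t, 0 <= t -> is_derive (fun t => Im (G t)) t (Im (dG t))) ->
  (forall t, 0 <= t -> Cmod (G t) <= K * exp (- (y * t))) ->
  (forall t, 0 <= t -> Cmod (dG t) <= K * y * exp (- (y * t))) ->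
  dominated_by (fun i => G (logn i)) (fun i => K * exp (- (y * logn i))).
Proof.
  intros Hy HR HI H0 H1. split.
  - intros i. apply H0, logn_ge_0.
  - intros i. pose proof (logn_ge_0 i). pose proof (logn_lt i).
    apply (Cmod_increment_le G dG (fun t => K * exp (- (y * t)))
             (fun t => - (K * y * exp (- (y * t)))));
      try (intros t Ht); try lra.
    + apply HR; lra.
    + apply HI; lra.
    + auto_derive; [exact I | ring].
    + rewrite Ropp_involutive. apply H1; lra.
Qed.

Lemma npow_neg_plus (m : nat) (s z : C) :
  npow_neg m (s + z) = (npow_neg m s * npow_neg m z)%C.
Proof. unfold npow_neg. rewrite <- cexp_plus. f_equal. ring. Qed.

Lemma npow_neg_RtoC (i : nat) (x : R) : npow_neg (S i) (RtoC x) = RtoC (exp (- (x * logn i))).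
Proof. unfold npow_neg. now rewrite <- RtoC_mult, <- RtoC_opp, cexp_RtoC. Qed.

Lemma Cmod_npow_neg (i : nat) (z : C) : Cmod (npow_neg (S i) z) = exp (- (Re z * logn i)).
Proof.
  unfold npow_neg. rewrite Cmod_cexp. f_equal. unfold logn.
  destruct z; simpl; ring.
Qed.

Lemma npow_neg_nz (i : nat) (z : C) : npow_neg (S i) z <> 0.
Proof. apply Cmod_gt_0. rewrite Cmod_npow_neg. apply exp_pos. Qed.

(** The derivative of [exp (- z t)] has modulus [|z| exp (- Re z t)], while the dominating
    exponential provides only a factor [Re z]; their ratio is the constant. *)
Lemma npow_neg_dominated (z : C) : 0 < Re z ->
  dominated_by (fun i => npow_neg (S i) z)
    (fun i => Cmod z / Re z * exp (- (Re z * logn i))).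
Proof.
  intros Hz.
  assert (Hzm : Re z <= Cmod z).
  { eapply Rle_trans; [apply Rle_abs | apply re_le_Cmod]. }
  destruct (dominated_of_derive (fun t => cexp (- z * RtoC t)) (fun t => (- z * cexp (- z * RtoC t))%C)
              (Cmod z / Re z) (Re z)) as [H1 H2].
  - exact Hz.
  - intros t _. apply cexp_line_derive.
  - intros t _. apply cexp_line_derive.
  - intros t _. rewrite Cmod_cexp.
    replace (Re (- z * RtoC t)%C) with (- (Re z * t)) by (destruct z; simpl; ring).
    rewrite <- (Rmult_1_l (exp _)) at 1. apply Rmult_le_compat_r; [left; apply exp_pos |].
    apply Rmult_le_reg_r with (Re z); [exact Hz |]. field_simplify; lra.
  - intros t _. rewrite Cmod_mult, Cmod_opp, Cmod_cexp.
    replace (Re (- z * RtoC t)%C) with (- (Re z * t)) by (destruct z; simpl; ring).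
    apply Req_le. field. lra.
  - assert (E : forall i, npow_neg (S i) z = cexp (- z * RtoC (logn i))).
    { intros i. unfold npow_neg, logn. f_equal. ring. }
    split; intros i; rewrite !E; auto.
Qed.

(** Abel summation in [j] bounds the partial sums of the weighted rows [r i] by [B * f n], because
    whole columns below [n] vanish; this bound then serves as the constant for Abel summation in
    [i]. *)
Lemma double_abel_leading (c : nat -> nat -> C) (E F : nat -> C) (e f : nat -> R)
    (B : R) (n M N : nat) :
  (forall M N, Cmod (Csum (fun i => Csum (fun j => c i j) N) M) <= B) ->
  (forall i j, (i < n)%nat \/ (j < n)%nat -> c i j = 0) ->
  dominated_by E e -> dominated_by F f -> (n <= M)%nat ->
  Cmod (Csum (fun i => Csum (fun j => c i j * E i * F j)%C N) M
        - Csum (fun j => c n j * F j)%C N * E n) <= 2 * (B * f n) * e (S n).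
Proof.
  intros HB Hc HE HF HM.
  set (r := fun i => Csum (fun j => c i j * F j)%C N).
  rewrite (Csum_eq _ (fun i => r i * E i)%C).
  2: { intros i _. unfold r. rewrite <- Csum_mult_r. apply Csum_eq. intros j _. ring. }
  change (Csum (fun j => c n j * F j)%C N) with (r n).
  apply abel_leading; try assumption.
  - intros m. unfold r. rewrite Csum_switch.
    rewrite (Csum_eq _ (fun j => Csum (fun i => c i j) m * F j)%C).
    2: { intros j _. apply Csum_mult_r. }
    apply abel_bound; try assumption.
    + intros k. rewrite <- Csum_switch. apply HB.
    + intros j Hj. apply Csum_zero. intros i _. apply Hc. now right.
  - intros i Hi. apply Csum_zero. intros j _. rewrite Hc by now left. ring.
Qed.

(** With the earlier rows zero, a partial sum of row [n] is a full rectangular sum. *)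
Lemma row_partial_bound (c : nat -> nat -> C) (B : R) (n N : nat) :
  (forall M N, Cmod (Csum (fun i => Csum (fun j => c i j) N) M) <= B) ->
  (forall i j, (i < n)%nat -> c i j = 0) ->
  Cmod (Csum (fun j => c n j) N) <= B.
Proof.
  intros HB Hc. specialize (HB n N). destruct n as [|n].
  - now rewrite Csum_0 in HB.
  - rewrite Csum_S, Csum_zero in HB.
    + now rewrite Cplus_0_l in HB.
    + intros i Hi. apply Csum_zero. intros j _. apply Hc. lia.
Qed.

(** * Dirichlet series are holomorphic *)

Lemma Ccauchy_ex_lim (u : nat -> C) :
  (forall eps, 0 < eps -> exists N, forall m n, (N <= m)%nat -> (m <= n)%nat ->
     Cmod (u n - u m) < eps) ->
  exists l : C, filterlim u eventually (locally l).
Proof.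
  intros H.
  apply (filterlim_locally_cauchy (U := C_CompleteNormedModule)).
  intros eps. destruct (H eps (cond_pos eps)) as [N HN].
  exists (fun n => (N <= n)%nat). split; [now exists N |].
  intros m n Hm Hn. apply C_NormedModule_mixin_compat1.
  change (Cmod (u n - u m) < eps).
  destruct (le_lt_dec m n) as [Hmn | Hmn].
  - now apply HN.
  - rewrite <- Cmod_opp, Copp_minus_distr. apply HN; lia.
Qed.

Lemma Cseq_prefix_bounded (u : nat -> C) (N : nat) :
  exists B, forall n, (n < N)%nat -> Cmod (u n) <= B.
Proof.
  induction N as [|N [B HB]].
  - exists 0. intros; lia.
  - exists (Rmax B (Cmod (u N))). intros n Hn.
    destruct (Nat.eq_dec n N) as [->|].
    + apply Rmax_r.
    + eapply Rle_trans; [apply HB; lia | apply Rmax_l].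
Qed.

Lemma Cseq_bounded (u : nat -> C) (l : C) :
  filterlim u eventually (locally l) -> exists B, forall n, Cmod (u n) <= B.
Proof.
  intros H. destruct (proj1 (Clim_eps u l) H 1 Rlt_0_1) as [N HN].
  destruct (Cseq_prefix_bounded u N) as [B HB].
  exists (Rmax B (Cmod l + 1)). intros n.
  destruct (le_lt_dec N n) as [Hn | Hn].
  - eapply Rle_trans; [| apply Rmax_r].
    replace (u n) with (l + (u n - l))%C by ring.
    eapply Rle_trans; [apply Cmod_triangle |].
    specialize (HN n Hn). lra.
  - eapply Rle_trans; [now apply HB | apply Rmax_l].
Qed.

Lemma exp_le_compat (u v : R) : u <= v -> exp u <= exp v.
Proof. intros [H | ->]; [left; now apply exp_increasing | lra]. Qed.

Lemma exp_ge_id (v : R) : v <= exp v.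
Proof. pose proof (exp_ineq1_le v). lra. Qed.

Lemma exp_neg_mult_le (v : R) : v * exp (- v) <= 1.
Proof.
  rewrite exp_Ropp. apply Rmult_le_reg_r with (exp v); [apply exp_pos |].
  rewrite Rmult_assoc, Rinv_l, Rmult_1_l, Rmult_1_r by (pose proof (exp_pos v); lra).
  apply exp_ge_id.
Qed.

(** Dirichlet's test. The block of terms after [m] is an Abel sum for the truncated sequence [d],
    hence at most [2 B e (S m)]. *)
Lemma abel_series_converges (c G : nat -> C) (e : nat -> R) (B : R) :
  (forall m, Cmod (Csum c m) <= B) -> dominated_by G e -> filterlim e eventually (locally 0) ->
  exists l : C, filterlim (Csum (fun i => c i * G i)%C) eventually (locally l).
Proof.
  intros HB HG He. apply Ccauchy_ex_lim. intros eps Heps.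
  assert (HB0 : 0 <= B) by (eapply Rle_trans; [apply Cmod_ge_0 | apply (HB 0%nat)]).
  assert (Heps' : 0 < eps / (2 * B + 1)) by (apply Rdiv_lt_0_compat; lra).
  destruct (He (fun y => y < eps / (2 * B + 1))) as [N HN]; [exact (open_lt _ 0 Heps') |].
  exists N. intros m n Hm Hn.
  set (d := fun i => if le_lt_dec i m then RtoC 0 else c i).
  assert (Hd0 : forall i, (i < S m)%nat -> d i = RtoC 0).
  { intros i Hi. unfold d. destruct (le_lt_dec i m); [reflexivity | lia]. }
  assert (Htail : forall (a b : nat -> C) k, (m <= k)%nat ->
      (forall i, (i <= m)%nat -> b i = RtoC 0) -> (forall i, (m < i)%nat -> b i = a i) ->
      Csum b k = (Csum a k - Csum a m)%C).
  { intros a b k Hk Hb0 Hba. induction Hk as [|k Hk IH].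
    - rewrite Csum_zero by assumption. ring.
    - rewrite !Csum_S, IH, Hba by lia. ring. }
  assert (HdB : forall k, Cmod (Csum d k) <= 2 * B).
  { intros k. destruct (le_lt_dec m k) as [Hk | Hk].
    - rewrite (Htail c).
      + eapply Rle_trans; [apply Cmod_triangle |]. rewrite Cmod_opp.
        pose proof (HB k). pose proof (HB m). lra.
      + exact Hk.
      + intros i Hi. apply Hd0. lia.
      + intros i Hi. unfold d. destruct (le_lt_dec i m); [lia | reflexivity].
    - rewrite Csum_zero; [rewrite Cmod_0; lra |]. intros i Hi. apply Hd0. lia. }
  rewrite <- (Htail _ (fun i => d i * G i)%C).
  - pose proof (abel_bound d G e (2 * B) (S m) n HdB Hd0 HG) as H.
    specialize (HN (S m) ltac:(lia)).
    assert (E : eps = (2 * B + 1) * (eps / (2 * B + 1))) by (field; lra).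
    assert (2 * B * e (S m) <= 2 * B * (eps / (2 * B + 1))) by (apply Rmult_le_compat_l; lra).
    lra.
  - exact Hn.
  - intros i Hi. rewrite Hd0 by lia. ring.
  - intros i Hi. unfold d. destruct (le_lt_dec i m); [lia | reflexivity].
Qed.

Lemma exp_neg_logn_lim (K y : R) : 0 < y ->
  filterlim (fun i => K * exp (- (y * logn i))) eventually (locally 0).
Proof.
  intros Hy.
  replace 0 with (real (Rbar_mult K 0)) by (simpl; ring).
  apply (is_lim_seq_scal_l _ _ (Finite 0)).
  apply filterlim_locally. intros eps.
  destruct (INR_unbounded (exp (- ln eps / y))) as [N HN]. exists N. intros n Hn.
  unfold ball; simpl; unfold AbsRing_ball, abs, minus, plus, opp; simpl.
  rewrite Ropp_0, Rplus_0_r, Rabs_right by (left; apply exp_pos).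
  rewrite <- (exp_ln eps) by apply cond_pos. apply exp_increasing.
  assert (H : - ln eps / y < logn n).
  { unfold logn. rewrite <- (ln_exp (- ln eps / y)).
    apply ln_increasing; [apply exp_pos |].
    eapply Rlt_le_trans; [exact HN |]. apply le_INR. lia. }
  apply Rmult_lt_compat_l with (r := y) in H; [| exact Hy].
  replace (y * (- ln eps / y)) with (- ln eps) in H by (field; lra). lra.
Qed.

Lemma exp_minus_1_le (v : R) : exp v - 1 <= v * exp v.
Proof.
  pose proof (exp_ineq1_le (- v)) as H. rewrite exp_Ropp in H.
  pose proof (exp_pos v) as Hv.
  apply Rmult_le_compat_r with (r := exp v) in H; [| lra].
  rewrite Rinv_l in H by lra. lra.
Qed.

(** Along the segment from 0 to [w] the speed of [cexp] is at most that of the real exponential of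
    [Cmod w * t]. The comparison function carries a minus sign because [Cmod_increment_le] wants it
    decreasing. *)
Lemma Cmod_cexp_minus_1_le (w : C) : Cmod (cexp w - 1) <= exp (Cmod w) - 1.
Proof.
  assert (H : Cmod (cexp (w * RtoC 0) - cexp (w * RtoC 1)) <= - exp (Cmod w * 0) - - exp (Cmod w * 1)).
  { apply (Cmod_increment_le (fun t => cexp (w * RtoC t)) (fun t => (w * cexp (w * RtoC t))%C)
             (fun t => - exp (Cmod w * t)) (fun t => - (Cmod w * exp (Cmod w * t)))); try lra.
    - intros t _. apply cexp_line_derive.
    - intros t _. apply cexp_line_derive.
    - intros t _. auto_derive; [exact I | ring].
    - intros t Ht. rewrite Cmod_mult, Cmod_cexp, Ropp_involutive.
      apply Rmult_le_compat_l; [apply Cmod_ge_0 |].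
      apply exp_le_compat.
      replace (Re (w * RtoC t)%C) with (Re w * t) by (destruct w; simpl; ring).
      assert (Re w <= Cmod w) by (eapply Rle_trans; [apply Rle_abs | apply re_le_Cmod]).
      nra. }
  rewrite Cmult_0_r, Cmult_1_r, cexp_0, Rmult_0_r, exp_0, Rmult_1_r in H.
  rewrite <- Cmod_opp, Copp_minus_distr. lra.
Qed.

(** Integrates the previous bound once more along the same segment. *)
Lemma Cmod_cexp_minus_1_minus_id_le (w : C) :
  Cmod (cexp w - 1 - w) <= exp (Cmod w) - 1 - Cmod w.
Proof.
  set (G := fun t => (cexp (w * RtoC t) - 1 - w * RtoC t)%C).
  assert (H : Cmod (G 0 - G 1) <=
     - (exp (Cmod w * 0) - Cmod w * 0) - - (exp (Cmod w * 1) - Cmod w * 1)).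
  { apply (Cmod_increment_le G (fun t => (w * (cexp (w * RtoC t) - 1))%C)
             (fun t => - (exp (Cmod w * t) - Cmod w * t))
             (fun t => - (Cmod w * (exp (Cmod w * t) - 1)))); try lra.
    - intros t _.
      apply (is_derive_ext (fun t => Re (cexp (w * RtoC t)) - (1 + Re w * t))).
      { intros u. unfold G. destruct w; simpl; ring. }
      replace (Re (w * (cexp (w * RtoC t) - 1))) with (Re (w * cexp (w * RtoC t)) - Re w)
        by (destruct w; simpl; ring).
      apply (is_derive_minus (K := R_AbsRing) (V := R_NormedModule)); [apply cexp_line_derive |].
      auto_derive; [exact I | ring].
    - intros t _.
      apply (is_derive_ext (fun t => Im (cexp (w * RtoC t)) - Im w * t)).
      { intros u. unfold G. destruct w; simpl; ring. }
      replace (Im (w * (cexp (w * RtoC t) - 1))) with (Im (w * cexp (w * RtoC t)) - Im w)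
        by (destruct w; simpl; ring).
      apply (is_derive_minus (K := R_AbsRing) (V := R_NormedModule)); [apply cexp_line_derive |].
      auto_derive; [exact I | ring].
    - intros t _. auto_derive; [exact I | ring].
    - intros t Ht. rewrite Cmod_mult, Ropp_involutive.
      apply Rmult_le_compat_l; [apply Cmod_ge_0 |].
      eapply Rle_trans; [apply Cmod_cexp_minus_1_le |].
      rewrite Cmod_mult, Cmod_R, Rabs_right by lra. lra. }
  unfold G in H.
  rewrite Cmult_0_r, Cmult_1_r, cexp_0, !Rmult_0_r, exp_0, !Rmult_1_r in H.
  rewrite <- Cmod_opp.
  replace (- (cexp w - 1 - w))%C with (1 - 1 - 0 - (cexp w - 1 - w))%C by ring. lra.
Qed.

Lemma exp_weight_derive (x p q : R) (u : R -> R) (t du : R) :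
  is_derive u t du ->
  is_derive (fun t => exp (- (x * t)) * (u t + p + q * t)) t
    (exp (- (x * t)) * (du + q - x * (u t + p + q * t))).
Proof.
  intros D. auto_derive.
  - exists du; exact D.
  - replace (Derive (fun x0 : R => u x0) t) with du by (symmetry; exact (is_derive_unique _ _ _ D)). ring.
Qed.

(** Makes the difference quotient of a Dirichlet series accessible to Abel summation: the weight
    [exp (- x t)] absorbs both the growth [exp (|h| t)] and the polynomial factors of the Taylor
    remainder, leaving a bound proportional to [|h|^2]. *)
Lemma exp_taylor_remainder_dominated (x : R) (h : C) : 0 < x -> Cmod h <= x / 2 ->
  dominated_by
    (fun i => RtoC (exp (- (x * logn i))) * (cexp (- h * RtoC (logn i)) - 1 + h * RtoC (logn i)))%C
    (fun i => Cmod h ^ 2 * (288 / x ^ 2) * exp (- (x / 4 * logn i))).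
Proof.
  intros Hx Hh.
  set (P := fun t => (cexp (- h * RtoC t) - 1 + h * RtoC t)%C).
  set (dP := fun t => (- h * (cexp (- h * RtoC t) - 1))%C).
  pose proof (Cmod_ge_0 h) as Hh0.
  assert (HP : forall t, 0 <= t -> Cmod (P t) <= (Cmod h * t) ^ 2 * exp (Cmod h * t)).
  { intros t Ht. unfold P.
    replace (cexp (- h * RtoC t) - 1 + h * RtoC t)%C
      with (cexp (- h * RtoC t) - 1 - (- h * RtoC t))%C by ring.
    eapply Rle_trans; [apply Cmod_cexp_minus_1_minus_id_le |].
    rewrite Cmod_mult, Cmod_opp, Cmod_R, Rabs_right by lra.
    assert (Hv : 0 <= Cmod h * t) by nra. set (v := Cmod h * t) in *.
    pose proof (exp_minus_1_le v). nra. }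
  assert (HdP : forall t, 0 <= t -> Cmod (dP t) <= Cmod h ^ 2 * t * exp (Cmod h * t)).
  { intros t Ht. unfold dP. rewrite Cmod_mult, Cmod_opp.
    replace (Cmod h ^ 2 * t * exp (Cmod h * t)) with (Cmod h * ((Cmod h * t) * exp (Cmod h * t))) by ring.
    apply Rmult_le_compat_l; [exact Hh0 |].
    eapply Rle_trans; [apply Cmod_cexp_minus_1_le |].
    rewrite Cmod_mult, Cmod_opp, Cmod_R, Rabs_right by lra. apply exp_minus_1_le. }
  (* Since [Cmod h <= x / 2], at least [x / 2 = x / 4 + x / 8 + x / 8] of the decay survives. Each
     of the two factors with [x / 8] can absorb one power of [t], at the price [8 / x]. *)
  assert (Hexp : forall t, 0 <= t ->
     exp (- (x * t)) * exp (Cmod h * t) <= exp (- (x / 4 * t)) * (exp (- (x / 8 * t)) * exp (- (x / 8 * t)))).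
  { intros t Ht. rewrite <- !exp_plus.
    apply exp_le_compat. nra. }
  assert (Hv : forall t, 0 <= t -> t * exp (- (x / 8 * t)) <= 8 / x).
  { intros t Ht. pose proof (exp_neg_mult_le (x / 8 * t)) as H.
    apply Rmult_le_reg_l with (x / 8); [lra |].
    replace (x / 8 * (8 / x)) with 1 by (field; lra). lra. }
  assert (He1 : forall t, 0 <= t -> 0 < exp (- (x / 8 * t)) <= 1).
  { intros t Ht. split; [apply exp_pos |]. rewrite <- exp_0.
    apply exp_le_compat. nra. }
  assert (Hsq : forall t, 0 <= t -> t ^ 2 * (exp (- (x * t)) * exp (Cmod h * t))
                  <= 64 / x ^ 2 * exp (- (x / 4 * t))).
  { intros t Ht. specialize (Hv t Ht). specialize (Hexp t Ht).
    destruct (He1 t Ht) as [He _].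
    eapply Rle_trans; [apply Rmult_le_compat_l; [nra | exact Hexp] |].
    set (E := exp (- (x / 8 * t))) in *.
    replace (t ^ 2 * (exp (- (x / 4 * t)) * (E * E))) with ((t * E) * (t * E) * exp (- (x / 4 * t))) by ring.
    apply Rmult_le_compat_r; [left; apply exp_pos |].
    replace (64 / x ^ 2) with (8 / x * (8 / x)) by (field; lra).
    assert (0 <= t * E) by nra.
    apply Rmult_le_compat; assumption. }
  assert (Hlin : forall t, 0 <= t -> t * (exp (- (x * t)) * exp (Cmod h * t))
                  <= 8 / x * exp (- (x / 4 * t))).
  { intros t Ht. specialize (Hv t Ht). specialize (Hexp t Ht).
    destruct (He1 t Ht) as [He He'].
    eapply Rle_trans; [apply Rmult_le_compat_l; [exact Ht | exact Hexp] |].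
    set (E := exp (- (x / 8 * t))) in *.
    replace (t * (exp (- (x / 4 * t)) * (E * E))) with ((t * E) * E * exp (- (x / 4 * t))) by ring.
    apply Rmult_le_compat_r; [left; apply exp_pos |].
    assert (0 <= t * E) by nra. nra. }
  apply (dominated_of_derive (fun t => RtoC (exp (- (x * t))) * P t)%C
           (fun t => RtoC (exp (- (x * t))) * (dP t - RtoC x * P t))%C).
  - lra.
  - intros t _.
    apply (is_derive_ext (fun t => exp (- (x * t)) * (Re (cexp (- h * RtoC t)) + -1 + Re h * t))).
    { intros u. unfold P. destruct h; simpl; ring. }
    destruct (cexp_line_derive (- h) t) as [D _].
    match goal with |- is_derive _ _ ?r => replace r with (exp (- (x * t)) * (Re (- h * cexp (- h * RtoC t)) + Re h
        - x * (Re (cexp (- h * RtoC t)) + -1 + Re h * t))) end.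
    + exact (exp_weight_derive x (-1) (Re h) _ _ _ D).
    + unfold P, dP. destruct h; simpl; ring.
  - intros t _.
    apply (is_derive_ext (fun t => exp (- (x * t)) * (Im (cexp (- h * RtoC t)) + 0 + Im h * t))).
    { intros u. unfold P. destruct h; simpl; ring. }
    destruct (cexp_line_derive (- h) t) as [_ D].
    match goal with |- is_derive _ _ ?r => replace r with (exp (- (x * t)) * (Im (- h * cexp (- h * RtoC t)) + Im h
        - x * (Im (cexp (- h * RtoC t)) + 0 + Im h * t))) end.
    + exact (exp_weight_derive x 0 (Im h) _ _ _ D).
    + unfold P, dP. destruct h; simpl; ring.
  - intros t Ht.
    rewrite Cmod_mult, Cmod_R, Rabs_right by (left; apply exp_pos).
    specialize (HP t Ht). specialize (Hsq t Ht).
    eapply Rle_trans; [apply Rmult_le_compat_l; [left; apply exp_pos | exact HP] |].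
    replace (exp (- (x * t)) * ((Cmod h * t) ^ 2 * exp (Cmod h * t)))
      with (Cmod h ^ 2 * (t ^ 2 * (exp (- (x * t)) * exp (Cmod h * t)))) by ring.
    rewrite Rmult_assoc. apply Rmult_le_compat_l; [nra |].
    eapply Rle_trans; [exact Hsq |].
    apply Rmult_le_compat_r; [left; apply exp_pos |].
    apply Rmult_le_compat_r; [left; apply Rinv_0_lt_compat; nra | lra].
  - intros t Ht.
    rewrite Cmod_mult, Cmod_R, Rabs_right by (left; apply exp_pos).
    specialize (HP t Ht). specialize (HdP t Ht). specialize (Hsq t Ht). specialize (Hlin t Ht).
    assert (H : Cmod (dP t - RtoC x * P t)
              <= Cmod h ^ 2 * t * exp (Cmod h * t) + x * ((Cmod h * t) ^ 2 * exp (Cmod h * t))).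
    { eapply Rle_trans; [apply Cmod_triangle |].
      rewrite Cmod_opp, Cmod_mult, Cmod_R, (Rabs_right x) by lra.
      apply Rplus_le_compat; [exact HdP |]. apply Rmult_le_compat_l; [lra | exact HP]. }
    eapply Rle_trans; [apply Rmult_le_compat_l; [left; apply exp_pos | exact H] |].
    replace (exp (- (x * t)) * (Cmod h ^ 2 * t * exp (Cmod h * t) + x * ((Cmod h * t) ^ 2 * exp (Cmod h * t))))
      with (Cmod h ^ 2 * (t * (exp (- (x * t)) * exp (Cmod h * t))
              + x * (t ^ 2 * (exp (- (x * t)) * exp (Cmod h * t))))) by ring.
    (* Origin of 288: the derivative costs [8 / x + x * (64 / x ^ 2) = 72 / x], which must equal the
       constant times the decay rate [x / 4]. *)
    replace (Cmod h ^ 2 * (288 / x ^ 2) * (x / 4) * exp (- (x / 4 * t)))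
      with (Cmod h ^ 2 * (8 / x * exp (- (x / 4 * t)) + x * (64 / x ^ 2 * exp (- (x / 4 * t)))))
      by (field; lra).
    apply Rmult_le_compat_l; [nra |].
    apply Rplus_le_compat; [exact Hlin |]. apply Rmult_le_compat_l; [lra | exact Hsq].
Qed.

(** These are the weights of the termwise differentiated series. Half of the decay absorbs the
    factor [t]; the derivative then costs [1 + 2 = 3], which is [6 / x] times the rate [x / 2]. *)
Lemma linear_exp_dominated (x : R) : 0 < x ->
  dominated_by (fun i => RtoC (- logn i * exp (- (x * logn i))))
    (fun i => 6 / x * exp (- (x / 2 * logn i))).
Proof.
  intros Hx.
  assert (Hv : forall t, 0 <= t -> t * exp (- (x * t)) <= 2 / x * exp (- (x / 2 * t))).
  { intros t Ht. pose proof (exp_neg_mult_le (x / 2 * t)) as H.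
    replace (- (x * t)) with (- (x / 2 * t) + - (x / 2 * t)) by field.
    rewrite exp_plus. pose proof (exp_pos (- (x / 2 * t))) as He.
    set (E := exp (- (x / 2 * t))) in *.
    rewrite <- Rmult_assoc. apply Rmult_le_compat_r; [lra |].
    apply Rmult_le_reg_l with (x / 2); [lra |].
    replace (x / 2 * (2 / x)) with 1 by (field; lra). lra. }
  assert (He : forall t, 0 <= t -> exp (- (x * t)) <= exp (- (x / 2 * t))).
  { intros t Ht. apply exp_le_compat. nra. }
  apply (dominated_of_derive (fun t => RtoC (- t * exp (- (x * t))))
           (fun t => RtoC ((- 1 + x * t) * exp (- (x * t))))).
  - lra.
  - intros t _. simpl. auto_derive; [exact I | ring].
  - intros t _. simpl. auto_derive; [exact I | ring].
  - intros t Ht. rewrite Cmod_R, Rabs_mult, Rabs_Ropp, (Rabs_right t), Rabs_right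
      by (try lra; left; apply exp_pos).
    eapply Rle_trans; [now apply Hv |].
    apply Rmult_le_compat_r; [left; apply exp_pos |].
    apply Rmult_le_compat_r; [left; now apply Rinv_0_lt_compat | lra].
  - intros t Ht. rewrite Cmod_R, Rabs_mult, (Rabs_right (exp _)) by (left; apply exp_pos).
    assert (Hab : Rabs (- 1 + x * t) <= 1 + x * t) by (apply Rabs_le; nra).
    eapply Rle_trans; [apply Rmult_le_compat_r; [left; apply exp_pos | exact Hab] |].
    specialize (Hv t Ht). specialize (He t Ht).
    replace (6 / x * (x / 2) * exp (- (x / 2 * t)))
      with (exp (- (x / 2 * t)) + x * (2 / x * exp (- (x / 2 * t)))) by (field; lra).
    apply Rmult_le_compat_l with (r := x) in Hv; lra.
Qed.

Lemma is_derive_of_quadratic_remainder (f : C -> C) (s l : C) (K d : R) :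
  0 < d -> (forall h, Cmod h <= d -> Cmod (f (s + h) - f s - h * l)%C <= K * Cmod h ^ 2) ->
  @is_derive C_AbsRing C_NormedModule f s l.
Proof.
  intros Hd H.
  assert (HK : 0 <= K).
  { specialize (H (RtoC d)). rewrite Cmod_R, Rabs_right in H by lra.
    specialize (H ltac:(lra)). pose proof (Cmod_ge_0 (f (s + RtoC d) - f s - RtoC d * l)%C).
    assert (0 < d ^ 2) by nra. nra. }
  split.
  - apply (is_linear_scal_l (K := C_AbsRing) (V := C_NormedModule)).
  - intros x Hx.
    assert (E : s = x) by exact (is_filter_lim_locally_unique (V := AbsRing_NormedModule C_AbsRing) s x Hx).
    subst x. intros eps.
    assert (Hpos : 0 < Rmin d (eps / (K + 1))).
    { apply Rmin_pos; [exact Hd |]. apply Rdiv_lt_0_compat; [apply cond_pos | lra]. }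
    exists (mkposreal _ Hpos). intros y Hy.
    change (Cmod (y - s) < Rmin d (eps / (K + 1))) in Hy.
    change (Cmod (f y - f s - (y - s) * l)%C <= eps * Cmod (y - s)).
    replace (f y) with (f (s + (y - s))%C) by (f_equal; ring).
    pose proof (Rmin_l d (eps / (K + 1))). pose proof (Rmin_r d (eps / (K + 1))).
    eapply Rle_trans; [apply H; lra |].
    pose proof (Cmod_ge_0 (y - s)).
    replace (K * Cmod (y - s) ^ 2) with ((K * Cmod (y - s)) * Cmod (y - s)) by ring.
    apply Rmult_le_compat_r; [assumption |].
    assert (Hle : Cmod (y - s) * (K + 1) <= eps).
    { replace (pos eps) with (eps / (K + 1) * (K + 1)) by (field; lra).
      apply Rmult_le_compat_r; lra. }
    nra.
Qed.

(** The series is expanded around [s0], a convergence point to the left of [s], whose terms [c] have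
    bounded partial sums. Relative to [c], the differentiated series and the second-order remainder
    are Abel sums with decaying weights, so the remainder is [O(|h|^2)] uniformly in the
    truncation. *)
Lemma holo_DirichletOn (rho : R) (b : nat -> C) (f : C -> C) :
  DirichletOn rho b f -> holo_on rho f.
Proof.
  intros Hf s Hs. unfold inH in Hs.
  (* Half the distance to the boundary: [s0] stays in the half-plane, and so does [s + h] for
     [Cmod h <= x / 2]. *)
  set (x := (Re s - rho) / 2). assert (Hx : 0 < x) by (unfold x; lra).
  set (s0 := (s - RtoC x)%C).
  set (c := dir_term b s0).
  assert (Hlim : forall t, inH rho t -> filterlim (Csum (dir_term b t)) eventually (locally (f t))).
  { intros t Ht. exact (Hf t Ht). }
  assert (Hs0 : inH rho s0).
  { unfold inH, s0, x. destruct s as [s1 s2]; simpl in *. lra. }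
  destruct (Cseq_bounded _ _ (Hlim s0 Hs0)) as [B HB].
  assert (Hc : forall z i, dir_term b (s0 + z) i = (c i * npow_neg (S i) z)%C).
  { intros z i. unfold c, dir_term. rewrite npow_neg_plus. ring. }
  set (G := fun i => RtoC (- logn i * exp (- (x * logn i)))).
  pose proof (linear_exp_dominated x Hx) as HG. fold G in HG.
  destruct (abel_series_converges c G _ B HB HG) as [l Hl].
  { apply exp_neg_logn_lim. lra. }
  exists l.
  apply (is_derive_of_quadratic_remainder f s l (B * (288 / x ^ 2)) (x / 2)); [lra |].
  intros h Hh.
  assert (Hsh : inH rho (s + h)).
  { pose proof (re_le_Cmod h) as H1. apply Rabs_le_between in H1.
    unfold inH. replace (Re (s + h)%C) with (Re s + Re h) by (destruct s, h; reflexivity).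
    unfold x in Hh. lra. }
  pose proof (Clim_minus _ _ _ _ (Clim_minus _ _ _ _ (Hlim _ Hsh) (Hlim s Hs))
                (Clim_mult _ _ _ _ (Clim_const h) Hl)) as Hdiff.
  refine (Clim_Cmod_le _ _ _ Hdiff _).
  exists 0%nat. intros n _.
  pose proof (exp_taylor_remainder_dominated x h Hx Hh) as HR.
  pose proof (abel_bound c _ _ B 0 n HB ltac:(intros; lia) HR) as Habel.
  cbv beta in Habel.
  replace (logn 0) with 0 in Habel by (unfold logn; simpl; now rewrite ln_1).
  rewrite Rmult_0_r, Ropp_0, exp_0, Rmult_1_r in Habel.
  replace (B * (288 / x ^ 2) * Cmod h ^ 2) with (B * (Cmod h ^ 2 * (288 / x ^ 2))) by ring.
  eapply Rle_trans; [| exact Habel]. apply Req_le. f_equal.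
  rewrite <- Csum_mult_l, <- !Csum_minus. apply Csum_eq. intros i _.
  replace (s + h)%C with (s0 + (RtoC x + h))%C by (unfold s0; ring).
  rewrite Hc.
  replace s with (s0 + RtoC x)%C at 1 by (unfold s0; ring).
  rewrite Hc, npow_neg_plus.
  assert (E2 : npow_neg (S i) h = cexp (- h * RtoC (logn i))).
  { unfold npow_neg, logn. f_equal. ring. }
  rewrite npow_neg_RtoC, E2. unfold G. rewrite RtoC_mult, RtoC_opp. ring.
Qed.

(** * The reproducing kernel Hilbert space of a positive semi-definite kernel *)

(* The list [(c_1, x_1), ..., (c_n, x_n)] stands for the function [sum_i c_i k(., x_i)]. *)
Fixpoint comb {X : Type} (k : X -> X -> C) (l : list (C * X)) (y : X) : C :=
  match l with
  | nil => RtoC 0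
  | cons (c, x) l' => (c * k y x + comb k l' y)%C
  end.

(** By the reproducing property this is the value that the inner product of [f] with the combination
    coded by [l] must have. It makes sense for any function [f], which allows passage to pointwise
    limits. *)
Fixpoint pairing {X : Type} (f : X -> C) (l : list (C * X)) : C :=
  match l with
  | nil => RtoC 0
  | cons (c, x) l' => (Cconj c * f x + pairing f l')%C
  end.

Definition form {X : Type} (k : X -> X -> C) (l m : list (C * X)) : C := pairing (comb k l) m.

Definition scall {X : Type} (a : C) (l : list (C * X)) : list (C * X) :=
  map (fun p => ((a * fst p)%C, snd p)) l.

Definition subl {X : Type} (l m : list (C * X)) : list (C * X) := l ++ scall (- RtoC 1)%C m.

Definition formsq {X : Type} (k : X -> X -> C) (l : list (C * X)) : R := Re (form k l l).

Definition psd {X : Type} (k : X -> X -> C) : Prop :=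
  forall l, Im (form k l l) = 0 /\ 0 <= formsq k l.

Lemma comb_app {X} (k : X -> X -> C) l m y : comb k (l ++ m) y = (comb k l y + comb k m y)%C.
Proof. induction l as [|[c x] l IH]; simpl; [ring | rewrite IH; ring]. Qed.

Lemma comb_scall {X} (k : X -> X -> C) a l y : comb k (scall a l) y = (a * comb k l y)%C.
Proof. induction l as [|[c x] l IH]; simpl; [ring | rewrite IH; ring]. Qed.

Lemma pairing_app {X} (f : X -> C) l m : pairing f (l ++ m) = (pairing f l + pairing f m)%C.
Proof. induction l as [|[c x] l IH]; simpl; [ring | rewrite IH; ring]. Qed.

Lemma pairing_scall {X} (f : X -> C) a l : pairing f (scall a l) = (Cconj a * pairing f l)%C.
Proof.
  induction l as [|[c x] l IH]; simpl; [ring |].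
  rewrite IH, Cmult_conj. ring.
Qed.

Lemma form_app_l {X} (k : X -> X -> C) l m p : form k (l ++ m) p = (form k l p + form k m p)%C.
Proof.
  unfold form. induction p as [|[c x] p IH]; simpl; [ring |].
  rewrite IH, comb_app. ring.
Qed.

Lemma form_scall_l {X} (k : X -> X -> C) a l p : form k (scall a l) p = (a * form k l p)%C.
Proof.
  unfold form. induction p as [|[c x] p IH]; simpl; [ring |].
  rewrite IH, comb_scall. ring.
Qed.

Lemma form_app_r {X} (k : X -> X -> C) l m p : form k l (m ++ p) = (form k l m + form k l p)%C.
Proof. apply pairing_app. Qed.

Lemma form_scall_r {X} (k : X -> X -> C) a l p : form k l (scall a p) = (Cconj a * form k l p)%C.
Proof. apply pairing_scall. Qed.

Lemma Cconj_RtoC (r : R) : Cconj (RtoC r) = RtoC r.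
Proof. unfold Cconj, RtoC; simpl. f_equal. ring. Qed.

Lemma form_single {X} (k : X -> X -> C) l y : form k l ((RtoC 1, y) :: nil) = comb k l y.
Proof. unfold form; simpl. rewrite Cconj_RtoC. ring. Qed.

(** Polarisation: reality of the form at [(1, x), (1, y)] gives the imaginary parts, and at
    [(1, x), (i, y)] the real parts. *)
Lemma psd_hermitian {X} (k : X -> X -> C) : psd k -> forall x y, k y x = Cconj (k x y).
Proof.
  intros H x y.
  destruct (H ((RtoC 1, x) :: nil)) as [Hx _].
  destruct (H ((RtoC 1, y) :: nil)) as [Hy _].
  destruct (H ((RtoC 1, x) :: (RtoC 1, y) :: nil)) as [H1 _].
  destruct (H ((RtoC 1, x) :: (Ci, y) :: nil)) as [H2 _].
  unfold form in *; simpl in *.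
  destruct (k x y) as [p q], (k y x) as [r s], (k x x) as [t u], (k y y) as [v w].
  unfold Cconj, Ci, Cmult, Cplus, RtoC in *; simpl in *. f_equal; lra.
Qed.

Lemma form_cons_l {X} (k : X -> X -> C) c x l m : psd k ->
  form k ((c, x) :: l) m = (c * Cconj (comb k m x) + form k l m)%C.
Proof.
  intros Hk. unfold form. induction m as [|[d y] m IH]; simpl.
  - rewrite Cconj_RtoC. ring.
  - simpl in IH. rewrite IH, Cplus_conj, Cmult_conj, <- (psd_hermitian k Hk x y). ring.
Qed.

Lemma form_hermitian {X} (k : X -> X -> C) l m : psd k -> form k m l = Cconj (form k l m).
Proof.
  intros Hk. induction l as [|[c x] l IH].
  - unfold form at 1; simpl. induction m as [|[d y] m IHm]; unfold form in *; simpl in *.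
    + now rewrite Cconj_RtoC.
    + rewrite Cmult_0_r, Cplus_0_l. exact IHm.
  - rewrite form_cons_l by assumption. rewrite Cplus_conj, Cmult_conj, Cconj_conj, <- IH.
    reflexivity.
Qed.

Lemma formsq_real {X} (k : X -> X -> C) l : psd k -> form k l l = RtoC (formsq k l).
Proof.
  intros Hk. destruct (Hk l) as [H _]. unfold formsq. destruct (form k l l); simpl in *.
  subst. reflexivity.
Qed.

Lemma formsq_app {X} (k : X -> X -> C) l m : psd k ->
  formsq k (l ++ m) = formsq k l + formsq k m + 2 * Re (form k l m).
Proof.
  intros Hk. unfold formsq. rewrite form_app_l, !form_app_r, (form_hermitian k l m Hk).
  destruct (form k l l), (form k l m), (form k m m). simpl. ring.
Qed.

Lemma formsq_scall {X} (k : X -> X -> C) a l : psd k ->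
  formsq k (scall a l) = Cmod a ^ 2 * formsq k l.
Proof.
  intros Hk. unfold formsq. rewrite form_scall_l, form_scall_r, formsq_real by assumption.
  rewrite Cmult_assoc, Cmod_sqr_conj. simpl. ring.
Qed.

Lemma form_cauchy_schwarz {X} (k : X -> X -> C) l m : psd k ->
  Cmod (form k l m) ^ 2 <= formsq k l * formsq k m.
Proof.
  intros Hk. set (b := form k l m). set (p := formsq k l). set (q := formsq k m).
  assert (Hp : 0 <= p) by apply Hk. assert (Hq : 0 <= q) by apply Hk.
  (* This is the square of [tau l - b m]; the coefficient [b] turns the cross term into a real
     number. *)
  assert (H : forall tau, 0 <= p * tau ^ 2 - 2 * tau * Cmod b ^ 2 + Cmod b ^ 2 * q).
  { intros tau. destruct (Hk (scall (RtoC tau) l ++ scall (- b)%C m)) as [_ H].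
    rewrite formsq_app, !formsq_scall in H by assumption.
    rewrite form_scall_l, form_scall_r, Cmod_opp, Cmod_R, pow2_abs in H. fold b p q in H.
    replace (Re (RtoC tau * (Cconj (- b) * b))) with (- (tau * Cmod b ^ 2)) in H.
    - lra.
    - rewrite Copp_conj. replace (- Cconj b * b)%C with (- (b * Cconj b))%C by ring.
      rewrite Cmod_sqr_conj. simpl. ring. }
  set (t := Cmod b ^ 2) in *. assert (Ht : 0 <= t) by apply pow2_ge_0.
  destruct (Rle_lt_or_eq_dec _ _ Hp) as [Hlt | Heq].
  - specialize (H (t / p)).
    replace (p * (t / p) ^ 2 - 2 * (t / p) * t + t * q) with (t / p * (p * q - t)) in H by (field; lra).
    destruct (Rle_lt_or_eq_dec _ _ Ht) as [Ht' | <-]; [| nra].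
    apply Rnot_lt_le. intros Hn.
    assert (0 < t / p) by now apply Rdiv_lt_0_compat. nra.
  (* For [p = 0] the polynomial is linear in [tau]; this value gives [- 2 |b|^2 >= 0]. *)
  - rewrite <- Heq in *. specialize (H (q / 2 + 1)).
    rewrite Rmult_0_l. destruct (Rle_lt_or_eq_dec _ _ Ht) as [Ht' | <-]; nra.
Qed.

Lemma formsq_subl {X} (k : X -> X -> C) l m : psd k ->
  formsq k (subl l m) = formsq k l + formsq k m - 2 * Re (form k l m).
Proof.
  intros Hk. unfold subl. rewrite formsq_app, formsq_scall, form_scall_r by assumption.
  rewrite Cmod_opp, Cmod_1, Copp_conj, Cconj_RtoC. destruct (form k l m); simpl. ring.
Qed.

(** The parallelogram law with the square of the difference dropped. Working with squares and a
    factor 2 replaces the triangle inequality and avoids square roots. *)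
Lemma formsq_app_le {X} (k : X -> X -> C) l m : psd k ->
  formsq k (l ++ m) <= 2 * formsq k l + 2 * formsq k m.
Proof.
  intros Hk. destruct (Hk (subl l m)) as [_ H].
  rewrite formsq_subl in H by assumption. rewrite formsq_app by assumption. lra.
Qed.

Lemma formsq_subl_sym {X} (k : X -> X -> C) l m : psd k ->
  formsq k (subl l m) = formsq k (subl m l).
Proof.
  intros Hk. rewrite !formsq_subl, (form_hermitian k m l) by assumption.
  destruct (form k m l); simpl. ring.
Qed.

Lemma formsq_subl_le {X} (k : X -> X -> C) l m p : psd k ->
  formsq k (subl l p) <= 2 * formsq k (subl l m) + 2 * formsq k (subl m p).
Proof.
  intros Hk. pose proof (formsq_app_le k (subl l m) (subl m p) Hk) as H.
  replace (formsq k (subl l p)) with (formsq k (subl l m ++ subl m p)); [exact H |].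
  rewrite formsq_app, !formsq_subl by assumption.
  unfold subl. rewrite form_app_l, !form_app_r, !form_scall_l, !form_scall_r, Copp_conj, Cconj_RtoC.
  rewrite (formsq_real k m Hk).
  destruct (form k l m), (form k l p), (form k m p). simpl. ring.
Qed.

(** The right side minus the left side is the square of [l - 2 m]. *)
Lemma formsq_le_subl {X} (k : X -> X -> C) l m : psd k ->
  formsq k l <= 2 * formsq k (subl l m) + 2 * formsq k m.
Proof.
  intros Hk. destruct (Hk (l ++ scall (- RtoC 2)%C m)) as [_ H].
  rewrite formsq_subl by assumption.
  rewrite formsq_app, formsq_scall, form_scall_r, Cmod_opp, Cmod_R, pow2_abs, Copp_conj, Cconj_RtoC in H
    by assumption.
  destruct (form k l m); simpl in *. lra.
Qed.

Definition cauchyl {X} (k : X -> X -> C) (u : nat -> list (C * X)) : Prop :=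
  forall eps, 0 < eps -> exists N, forall m n, (N <= m)%nat -> (N <= n)%nat ->
    formsq k (subl (u m) (u n)) < eps.

Definition represents {X} (k : X -> X -> C) (u : nat -> list (C * X)) (f : X -> C) : Prop :=
  cauchyl k u /\ forall y, filterlim (fun n => comb k (u n) y) eventually (locally (f y)).

Lemma cauchyl_bounded {X} (k : X -> X -> C) u : psd k -> cauchyl k u ->
  exists B N, 0 < B /\ forall n, (N <= n)%nat -> formsq k (u n) <= B.
Proof.
  intros Hk H. destruct (H 1 Rlt_0_1) as [N HN].
  exists (2 + 2 * formsq k (u N)), N. destruct (Hk (u N)) as [_ H0].
  split; [lra |]. intros n Hn.
  pose proof (formsq_le_subl k (u n) (u N) Hk). specialize (HN n N Hn (le_n N)). lra.
Qed.

Lemma pairing_lim {X} (u : nat -> X -> C) (f : X -> C) (l : list (C * X)) :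
  (forall y, filterlim (fun n => u n y) eventually (locally (f y))) ->
  filterlim (fun n => pairing (u n) l) eventually (locally (pairing f l)).
Proof.
  intros H. induction l as [|[c x] l IH]; simpl.
  - apply Clim_const.
  - apply Clim_plus; [| exact IH]. apply Clim_mult; [apply Clim_const | apply H].
Qed.

(** The crux of the functional completion: a Cauchy sequence tending to 0 pointwise tends to 0 in
    norm. For a fixed late [N], the pairing of [u n] with [u N] involves finitely many values of
    [comb k (u n)] and so tends to 0, while [u n - u N] is small in norm. *)
Lemma represents_zero {X} (k : X -> X -> C) u f : psd k ->
  represents k u f -> (forall y, f y = RtoC 0) ->
  forall eps, 0 < eps -> exists N, forall n, (N <= n)%nat -> formsq k (u n) < eps.
Proof.
  intros Hk [Hu Hf] H0 eps Heps.
  destruct (Hu (eps / 2) ltac:(lra)) as [N HN].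
  pose proof (pairing_lim (fun n => comb k (u n)) f (u N) Hf) as Hp.
  assert (E : pairing f (u N) = RtoC 0).
  { clear - H0. induction (u N) as [|[c x] l IH]; simpl; [reflexivity |].
    rewrite IH, H0. ring. }
  rewrite E in Hp.
  destruct (proj1 (Clim_eps _ _) Hp (eps / 4) ltac:(lra)) as [N' HN'].
  exists (max N N'). intros n Hn.
  specialize (HN n N ltac:(lia) (le_n N)). specialize (HN' n ltac:(lia)).
  rewrite formsq_subl in HN by assumption. destruct (Hk (u N)) as [_ HuN].
  unfold form in HN. replace (pairing (comb k (u n)) (u N) - RtoC 0)%C with (pairing (comb k (u n)) (u N)) in HN' by ring.
  pose proof (re_le_Cmod (pairing (comb k (u n)) (u N))) as Hre. apply Rabs_le_between in Hre. lra.
Qed.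

Lemma Cmod_lt_of_sqr (z : C) (eps : R) : 0 < eps -> Cmod z ^ 2 < eps ^ 2 -> Cmod z < eps.
Proof. intros He H. pose proof (Cmod_ge_0 z). apply Rnot_le_lt. intros Hn. nra. Qed.

Lemma form_small {X} (k : X -> X -> C) l m eps B : psd k -> 0 < eps -> 0 < B ->
  formsq k l < eps ^ 2 / B -> formsq k m <= B -> Cmod (form k l m) < eps.
Proof.
  intros Hk He HB Hl Hm. apply Cmod_lt_of_sqr; [exact He |].
  eapply Rle_lt_trans; [apply form_cauchy_schwarz, Hk |].
  destruct (Hk l) as [_ H0]. destruct (Hk m) as [_ H1].
  apply Rle_lt_trans with (formsq k l * B); [now apply Rmult_le_compat_l |].
  apply Rmult_lt_compat_r with (r := B) in Hl; [| exact HB].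
  replace (eps ^ 2 / B * B) with (eps ^ 2) in Hl by (field; lra). exact Hl.
Qed.

Lemma form_cauchy_lim {X} (k : X -> X -> C) u v : psd k -> cauchyl k u -> cauchyl k v ->
  exists l : C, filterlim (fun n => form k (u n) (v n)) eventually (locally l).
Proof.
  intros Hk Hu Hv. apply Ccauchy_ex_lim. intros eps Heps.
  destruct (cauchyl_bounded k u Hk Hu) as [Bu [Nu [HBu HNu]]].
  destruct (cauchyl_bounded k v Hk Hv) as [Bv [Nv [HBv HNv]]].
  assert (Hsq : 0 < (eps / 2) ^ 2) by nra.
  destruct (Hu ((eps / 2) ^ 2 / Bv)) as [N1 HN1]; [now apply Rdiv_lt_0_compat |].
  destruct (Hv ((eps / 2) ^ 2 / Bu)) as [N2 HN2]; [now apply Rdiv_lt_0_compat |].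
  exists (max (max Nu Nv) (max N1 N2)). intros m n Hm Hn.
  replace (form k (u n) (v n) - form k (u m) (v m))%C
    with (form k (subl (u n) (u m)) (v n) + Cconj (form k (subl (v n) (v m)) (u m)))%C.
  - eapply Rle_lt_trans; [apply Cmod_triangle |]. rewrite Cmod_conj.
    assert (Cmod (form k (subl (u n) (u m)) (v n)) < eps / 2).
    { apply form_small with Bv; try assumption; [lra | apply HN1; lia | apply HNv; lia]. }
    assert (Cmod (form k (subl (v n) (v m)) (u m)) < eps / 2).
    { apply form_small with Bu; try assumption; [lra | apply HN2; lia | apply HNu; lia]. }
    lra.
  - rewrite <- (form_hermitian k _ (u m) Hk). unfold subl.
    rewrite form_app_l, form_app_r, form_scall_l, form_scall_r, Copp_conj, Cconj_RtoC. ring.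
Qed.

Lemma represents_app {X} (k : X -> X -> C) u v f g h : psd k ->
  represents k u f -> represents k v g -> (forall y, h y = f y + g y)%C ->
  represents k (fun n => u n ++ v n) h.
Proof.
  intros Hk [Hu Hf] [Hv Hg] Hh. split.
  - intros eps Heps.
    destruct (Hu (eps / 4) ltac:(lra)) as [N1 H1]. destruct (Hv (eps / 4) ltac:(lra)) as [N2 H2].
    exists (max N1 N2). intros m n Hm Hn.
    specialize (H1 m n ltac:(lia) ltac:(lia)). specialize (H2 m n ltac:(lia) ltac:(lia)).
    pose proof (formsq_app_le k (subl (u m) (u n)) (subl (v m) (v n)) Hk) as H.
    replace (formsq k (subl (u m ++ v m) (u n ++ v n)))
      with (formsq k (subl (u m) (u n) ++ subl (v m) (v n))); [lra |].
    rewrite formsq_app, !formsq_subl, !formsq_app by assumption. unfold subl.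
    rewrite !form_app_l, !form_app_r, !form_scall_l, !form_scall_r, Copp_conj, Cconj_RtoC.
    rewrite (form_hermitian k (u n) (v m)) by assumption.
    destruct (form k (u n) (v m)), (form k (u m) (v m)), (form k (u n) (v n)), (form k (u m) (v n)),
      (form k (u m) (u n)), (form k (v m) (v n)). simpl. ring.
  - intros y. rewrite Hh.
    apply filterlim_ext with (fun n => (comb k (u n) y + comb k (v n) y)%C).
    + intros n. now rewrite comb_app.
    + now apply Clim_plus.
Qed.

Lemma represents_scall {X} (k : X -> X -> C) a u f h : psd k ->
  represents k u f -> (forall y, h y = a * f y)%C -> represents k (fun n => scall a (u n)) h.
Proof.
  intros Hk [Hu Hf] Hh. split.
  - intros eps Heps.
    pose proof (pow2_ge_0 (Cmod a)) as Ha.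
    destruct (Hu (eps / (Cmod a ^ 2 + 1))) as [N HN]; [apply Rdiv_lt_0_compat; lra |].
    exists N. intros m n Hm Hn. specialize (HN m n Hm Hn).
    replace (formsq k (subl (scall a (u m)) (scall a (u n))))
      with (formsq k (scall a (subl (u m) (u n)))).
    + rewrite formsq_scall by assumption. destruct (Hk (subl (u m) (u n))) as [_ H0].
      apply Rmult_lt_compat_r with (r := Cmod a ^ 2 + 1) in HN; [| lra].
      replace (eps / (Cmod a ^ 2 + 1) * (Cmod a ^ 2 + 1)) with eps in HN by (field; lra). lra.
    + rewrite formsq_scall, !formsq_subl, !formsq_scall, form_scall_l, form_scall_r by assumption.
      rewrite Cmult_assoc, Cmod_sqr_conj. destruct (form k (u m) (u n)). simpl. ring.
  - intros y. rewrite Hh.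
    apply filterlim_ext with (fun n => (a * comb k (u n) y)%C).
    + intros n. now rewrite comb_scall.
    + apply Clim_mult; [apply Clim_const | apply Hf].
Qed.

Lemma represents_subl {X} (k : X -> X -> C) u v f g h : psd k ->
  represents k u f -> represents k v g -> (forall y, h y = f y - g y)%C ->
  represents k (fun n => subl (u n) (v n)) h.
Proof.
  intros Hk Hu Hv Hh. unfold subl.
  apply represents_app with f (fun y => (- RtoC 1 * g y)%C); try assumption.
  - apply represents_scall with g; auto.
  - intros y. rewrite Hh. ring.
Qed.

Lemma represents_const {X} (k : X -> X -> C) l f : psd k ->
  (forall y, f y = comb k l y) -> represents k (fun _ => l) f.
Proof.
  intros Hk Hf. split.
  - intros eps Heps. exists 0%nat. intros _ _ _ _. rewrite formsq_subl by assumption.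
    unfold formsq. lra.
  - intros y. rewrite Hf. apply Clim_const.
Qed.

(** Two representing sequences of [f] differ by one that represents 0, hence by one null in norm;
    Cauchy-Schwarz against the bounded [v] does the rest. *)
Lemma form_lim_irrelevant {X} (k : X -> X -> C) u u' v f z : psd k ->
  represents k u f -> represents k u' f -> cauchyl k v ->
  filterlim (fun n => form k (u n) (v n)) eventually (locally z) ->
  filterlim (fun n => form k (u' n) (v n)) eventually (locally z).
Proof.
  intros Hk Hu Hu' Hv Hlim.
  assert (H0 : represents k (fun n => subl (u' n) (u n)) (fun _ => RtoC 0)).
  { apply represents_subl with f f; try assumption. intros y. ring. }
  apply filterlim_ext with (fun n => form k (u n) (v n) + form k (subl (u' n) (u n)) (v n))%C.
  { intros n. unfold subl. rewrite form_app_l, form_scall_l. ring. }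
  replace z with (z + RtoC 0)%C by ring. apply Clim_plus; [exact Hlim |].
  apply Clim_eps. intros eps Heps.
  destruct (cauchyl_bounded k v Hk Hv) as [B [N [HB HN]]].
  destruct (represents_zero k _ _ Hk H0 (fun _ => eq_refl) (eps ^ 2 / B)) as [N' HN'].
  { apply Rdiv_lt_0_compat; nra. }
  exists (max N N'). intros n Hn.
  replace (_ - RtoC 0)%C with (form k (subl (u' n) (u n)) (v n)) by ring.
  apply form_small with B; try assumption; [apply HN'; lia | apply HN; lia].
Qed.

Definition rkhs_space {X} (k : X -> X -> C) (f : X -> C) : Prop := exists u, represents k u f.

(** The inner product must be a total operation on functions, so the limit is chosen by [epsilon];
    outside [rkhs_space] the value is arbitrary. *)
Definition rkhs_ip {X} (k : X -> X -> C) (f g : X -> C) : C :=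
  epsilon (inhabits (RtoC 0)) (fun z => exists u v, represents k u f /\ represents k v g /\
    filterlim (fun n => form k (u n) (v n)) eventually (locally z)).

Lemma rkhs_ip_lim {X} (k : X -> X -> C) u v f g : psd k ->
  represents k u f -> represents k v g ->
  filterlim (fun n => form k (u n) (v n)) eventually (locally (rkhs_ip k f g)).
Proof.
  intros Hk Hu Hv. unfold rkhs_ip.
  match goal with |- context [epsilon ?i ?P] => assert (H : P (epsilon i P)) end.
  { apply epsilon_spec. destruct (form_cauchy_lim k u v Hk (proj1 Hu) (proj1 Hv)) as [l Hl].
    exists l, u, v. auto. }
  destruct H as [u' [v' [Hu' [Hv' Hl]]]].
  set (z := epsilon _ _) in *. clearbody z.
  (* Only the first argument can be exchanged this way; the second is exchanged after
     conjugating. *)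
  apply (form_lim_irrelevant k u' u v f z Hk Hu' Hu (proj1 Hv)).
  apply filterlim_ext with (fun n => Cconj (form k (v n) (u' n))).
  { intros n. now rewrite <- form_hermitian. }
  rewrite <- (Cconj_conj z). apply Clim_conj.
  apply (form_lim_irrelevant k v' v u' g _ Hk Hv' Hv (proj1 Hu')).
  apply filterlim_ext with (fun n => Cconj (form k (u' n) (v' n))).
  { intros n. now rewrite <- form_hermitian. }
  now apply Clim_conj.
Qed.

Lemma rkhs_formsq_lim {X} (k : X -> X -> C) u f : psd k -> represents k u f ->
  filterlim (fun n => formsq k (u n)) eventually (locally (Re (rkhs_ip k f f))).
Proof. intros Hk Hu. apply (Clim_Re (fun n => form k (u n) (u n))). now apply rkhs_ip_lim. Qed.

Lemma rkhs_normsq_le {X} (k : X -> X -> C) u f (B : R) : psd k -> represents k u f ->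
  eventually (fun n => formsq k (u n) <= B) -> Re (rkhs_ip k f f) <= B.
Proof.
  intros Hk Hu HB.
  exact (filterlim_le (F := eventually) _ (fun _ => B) (Finite _) (Finite B) HB
           (rkhs_formsq_lim k u f Hk Hu) (filterlim_const B)).
Qed.

Lemma rkhs_normsq_ge_0 {X} (k : X -> X -> C) f : psd k -> rkhs_space k f ->
  0 <= Re (rkhs_ip k f f).
Proof.
  intros Hk [u Hu].
  apply (filterlim_le (F := eventually) (fun _ => 0) (fun n => formsq k (u n)) (Finite 0) (Finite _)).
  - exists 0%nat. intros n _. apply Hk.
  - apply filterlim_const.
  - exact (rkhs_formsq_lim k u f Hk Hu).
Qed.

Lemma rkhs_eventually_lt {X} (k : X -> X -> C) u f (B : R) : psd k -> represents k u f ->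
  Re (rkhs_ip k f f) < B -> exists N, forall n, (N <= n)%nat -> formsq k (u n) < B.
Proof.
  intros Hk Hu HB. pose proof (rkhs_formsq_lim k u f Hk Hu) as H.
  apply (H (fun y => y < B)). exact (open_lt B _ HB).
Qed.

Lemma represents_kernel {X} (k : X -> X -> C) (t : X) : psd k ->
  represents k (fun _ => (RtoC 1, t) :: nil) (fun y => k y t).
Proof. intros Hk. apply represents_const; [exact Hk |]. intros y. simpl. ring. Qed.

Lemma rkhs_reproducing {X} (k : X -> X -> C) f t : psd k -> rkhs_space k f ->
  rkhs_ip k f (fun y => k y t) = f t.
Proof.
  intros Hk [u Hu].
  refine (Clim_unique (F := eventually) (fun n => form k (u n) ((RtoC 1, t) :: nil)) _ _ _ _).
  - apply (rkhs_ip_lim k u (fun _ => (RtoC 1, t) :: nil)); auto. now apply represents_kernel.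
  - apply filterlim_ext with (fun n => comb k (u n) t).
    + intros n. now rewrite form_single.
    + apply Hu.
Qed.

Lemma formsq_single {X} (k : X -> X -> C) t : formsq k ((RtoC 1, t) :: nil) = Re (k t t).
Proof.
  unfold formsq. rewrite form_single. simpl. unfold Re. ring.
Qed.

Lemma comb_sqr_le {X} (k : X -> X -> C) l t : psd k ->
  Cmod (comb k l t) ^ 2 <= formsq k l * Re (k t t).
Proof.
  intros Hk. rewrite <- form_single, <- formsq_single. now apply form_cauchy_schwarz.
Qed.

(** A diagonal argument: [phi n] is so late that [U n (phi n)] is within squared distance
    [1 / (n + 1)] of every later term of [U n]. The diagonal [L] is Cauchy, and its pointwise limit
    is the limit of [F]. *)
Lemma rkhs_complete {X} (k : X -> X -> C) (F : nat -> X -> C) : psd k ->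
  (forall n, rkhs_space k (F n)) ->
  (forall eps, 0 < eps -> exists N, forall m n, (N <= m)%nat -> (N <= n)%nat ->
     Re (rkhs_ip k (fun y => F m y - F n y)%C (fun y => F m y - F n y)%C) < eps) ->
  exists f, rkhs_space k f /\ forall eps, 0 < eps -> exists N, forall n, (N <= n)%nat ->
     Re (rkhs_ip k (fun y => F n y - f y)%C (fun y => F n y - f y)%C) < eps.
Proof.
  intros Hk HF Hc.
  destruct (choice (fun n u => represents k u (F n)) HF) as [U HU].
  destruct (choice (fun n N => forall j, (N <= j)%nat ->
              formsq k (subl (U n N) (U n j)) < / INR (S n))) as [phi Hphi].
  { intros n. destruct (proj1 (HU n) (/ INR (S n))) as [N HN].
    - apply Rinv_0_lt_compat, lt_0_INR. lia.
    - exists N. intros j Hj. apply HN; lia. }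
  set (L := fun n => U n (phi n)).
  assert (Hinv : forall eps, 0 < eps -> exists N, forall n, (N <= n)%nat -> / INR (S n) < eps).
  { intros eps Heps. destruct (INR_unbounded (/ eps)) as [N HN]. exists N. intros n Hn.
    rewrite <- (Rinv_inv eps). apply Rinv_lt_contravar.
    - apply Rmult_lt_0_compat; [now apply Rinv_0_lt_compat | apply lt_0_INR; lia].
    - eapply Rlt_le_trans; [exact HN |]. apply le_INR. lia. }
  assert (HL : cauchyl k L).
  { intros eps Heps.
    (* Two uses of [formsq_subl_le] give the weights [2 + 4 + 4 = 10], below 16. *)
    destruct (Hinv (eps / 16) ltac:(lra)) as [N1 HN1].
    destruct (Hc (eps / 16) ltac:(lra)) as [N2 HN2].
    exists (max N1 N2). intros m n Hm Hn.
    destruct (rkhs_eventually_lt k (fun j => subl (U m j) (U n j)) _ (eps / 16) Hk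
               (represents_subl k _ _ _ _ _ Hk (HU m) (HU n) (fun y => eq_refl)))
      as [N3 HN3].
    { apply HN2; lia. }
    set (j := max N3 (max (phi m) (phi n))).
    specialize (HN3 j ltac:(unfold j; lia)).
    pose proof (Hphi m j ltac:(unfold j; lia)) as Hpm.
    pose proof (Hphi n j ltac:(unfold j; lia)) as Hpn.
    pose proof (HN1 m ltac:(lia)). pose proof (HN1 n ltac:(lia)).
    pose proof (formsq_subl_le k (L m) (U m j) (L n) Hk).
    pose proof (formsq_subl_le k (U m j) (U n j) (L n) Hk).
    rewrite (formsq_subl_sym k (U n j) (L n) Hk) in *. unfold L in *. lra. }
  assert (Hpt : forall y, exists z : C, filterlim (fun n => comb k (L n) y) eventually (locally z)).
  { intros y. apply Ccauchy_ex_lim. intros eps Heps.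
    assert (Hy : 0 <= Re (k y y)) by (rewrite <- formsq_single; apply Hk).
    destruct (HL (eps ^ 2 / (Re (k y y) + 1))) as [N HN].
    { apply Rdiv_lt_0_compat; nra. }
    exists N. intros m n Hm Hn. specialize (HN n m ltac:(lia) ltac:(lia)).
    replace (comb k (L n) y - comb k (L m) y)%C with (form k (subl (L n) (L m)) ((RtoC 1, y) :: nil)).
    - apply form_small with (Re (k y y) + 1); try assumption; [lra |].
      rewrite formsq_single. lra.
    - rewrite form_single. unfold subl. rewrite comb_app, comb_scall. ring. }
  destruct (choice (fun y z => filterlim (fun n => comb k (L n) y) eventually (locally z)) Hpt)
    as [f Hf].
  assert (HLf : represents k L f) by (split; assumption).
  exists f. split; [now exists L |].
  intros eps Heps.
  destruct (Hinv (eps / 8) ltac:(lra)) as [N1 HN1].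
  destruct (HL (eps / 8) ltac:(lra)) as [N2 HN2].
  exists (max N1 N2). intros n Hn.
  apply Rle_lt_trans with (eps / 2); [| lra].
  apply (rkhs_normsq_le k (fun j => subl (U n j) (L j)) _ _ Hk).
  - apply represents_subl with (F n) f; auto.
  - exists (max N2 (phi n)). intros j Hj.
    pose proof (formsq_subl_le k (U n j) (L n) (L j) Hk).
    rewrite (formsq_subl_sym k (U n j) (L n) Hk) in *.
    pose proof (Hphi n j ltac:(lia)). pose proof (HN1 n ltac:(lia)).
    pose proof (HN2 n j ltac:(lia) ltac:(lia)). unfold L in *. lra.
Qed.

(** Existence is what lets (iv) be applied: its hypothesis ranges over all pairs [V], [ip]
    satisfying [IsRKHS]. *)
Lemma moore_aronszajn (rho : R) (k : C -> C -> C) :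
  psd (fun x y : Hr rho => k (proj1_sig x) (proj1_sig y)) -> exists V ip, IsRKHS rho k V ip.
Proof.
  set (kr := fun x y : Hr rho => k (proj1_sig x) (proj1_sig y)). intros Hk.
  exists (rkhs_space kr), (rkhs_ip kr).
  assert (Hsqrt : forall x eps, 0 < eps -> 0 <= x -> sqrt x < eps -> x < eps ^ 2).
  { intros x eps He Hx H. rewrite <- (pow2_sqrt x Hx).
    pose proof (sqrt_pos x). nra. }
  assert (Hsub : forall f g, rkhs_space kr f -> rkhs_space kr g -> rkhs_space kr (fun y => f y - g y)%C).
  { intros f g [u Hu] [v Hv]. exists (fun n => subl (u n) (v n)).
    apply represents_subl with f g; auto. }
  unfold IsRKHS. cbv zeta. repeat match goal with |- _ /\ _ => split end.
  - exists (fun _ => nil). apply represents_const; [exact Hk | reflexivity].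
  - intros f g [u Hu] [v Hv]. exists (fun n => u n ++ v n). apply represents_app with f g; auto.
  - intros c f [u Hu]. exists (fun n => scall c (u n)). apply represents_scall with f; auto.
  - intros f g h [u Hu] [v Hv] [w Hw].
    refine (Clim_unique (F := eventually) (fun n => form kr (u n ++ v n) (w n)) _ _ _ _).
    + apply rkhs_ip_lim; auto. apply represents_app with f g; auto.
    + apply filterlim_ext with (fun n => form kr (u n) (w n) + form kr (v n) (w n))%C.
      { intros n. now rewrite form_app_l. }
      apply Clim_plus; now apply rkhs_ip_lim.
  - intros c f g [u Hu] [v Hv].
    refine (Clim_unique (F := eventually) (fun n => form kr (scall c (u n)) (v n)) _ _ _ _).
    + apply rkhs_ip_lim; auto. apply represents_scall with f; auto.
    + apply filterlim_ext with (fun n => c * form kr (u n) (v n))%C.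
      { intros n. now rewrite form_scall_l. }
      apply Clim_mult; [apply Clim_const | now apply rkhs_ip_lim].
  - intros f g [u Hu] [v Hv].
    refine (Clim_unique (F := eventually) (fun n => form kr (v n) (u n)) _ _ _ _).
    + now apply rkhs_ip_lim.
    + apply filterlim_ext with (fun n => Cconj (form kr (u n) (v n))).
      { intros n. now rewrite <- form_hermitian. }
      apply Clim_conj. now apply rkhs_ip_lim.
  - intros f Hf. now apply rkhs_normsq_ge_0.
  (* Definiteness: [|f t|^2] is bounded by the squared norm times [k t t]; the [+ 1] below covers
     [k t t = 0]. *)
  - intros f [u Hu] H0. apply functional_extensionality. intros t.
    apply Cmod_eq_0. apply Rle_antisym; [| apply Cmod_ge_0].
    apply le_epsilon. intros eps Heps. rewrite Rplus_0_l.
    assert (Ht : 0 <= Re (kr t t)) by (rewrite <- formsq_single; apply Hk).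
    destruct (rkhs_eventually_lt kr u f (eps ^ 2 / (Re (kr t t) + 1)) Hk Hu) as [N HN].
    { rewrite H0. simpl. apply Rdiv_lt_0_compat; nra. }
    apply (Clim_Cmod_le (F := eventually) (fun n => comb kr (u n) t)); [apply Hu |].
    exists N. intros n Hn. specialize (HN n Hn). left.
    rewrite <- form_single.
    apply form_small with (Re (kr t t) + 1); try assumption; [lra |]. rewrite formsq_single. lra.
  - intros u Hu Hc.
    destruct (rkhs_complete kr u Hk Hu) as [f [Hf Hlim]].
    { intros eps Heps. destruct (Hc (sqrt eps) (sqrt_lt_R0 _ Heps)) as [N HN].
      exists N. intros m n Hm Hn. rewrite <- (pow2_sqrt eps) by lra.
      apply Hsqrt; [now apply sqrt_lt_R0 | | now apply HN].
      apply rkhs_normsq_ge_0; auto. }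
    exists f. split; [exact Hf |]. intros eps Heps.
    destruct (Hlim (eps ^ 2) ltac:(nra)) as [N HN]. exists N. intros n Hn.
    rewrite <- (sqrt_pow2 eps) by lra. apply sqrt_lt_1_alt. split; [| now apply HN].
    apply (rkhs_normsq_ge_0 kr (fun y => u n y - f y)%C); auto.
  - intros t. exists (fun _ => (RtoC 1, t) :: nil). now apply (represents_kernel kr).
  - intros f t Hf. now apply (rkhs_reproducing kr).
Qed.

(** * Leading coefficients of positive semi-definite Dirichlet series kernels *)

Lemma Csum_shift (a : nat -> C) (n : nat) : Csum a (S n) = (a 0%nat + Csum (fun i => a (S i)) n)%C.
Proof.
  induction n as [|n IH].
  - now rewrite Csum_S, !Csum_0.
  - rewrite Csum_S, IH, (Csum_S (fun i => a (S i))). ring.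
Qed.

Lemma comb_Csum {X : Type} (k : X -> X -> C) (p0 p : C * X) (l : list (C * X)) (y : X) :
  comb k (p :: l) y
  = Csum (fun j => fst (nth j (p :: l) p0) * k y (snd (nth j (p :: l) p0)))%C (length l).
Proof.
  revert p. induction l as [|q l IH]; intros [c x].
  - simpl. rewrite Csum_0. simpl. ring.
  - change (length (q :: l)) with (S (length l)). rewrite Csum_shift.
    change (comb k ((c, x) :: q :: l) y) with (c * k y x + comb k (q :: l) y)%C.
    rewrite IH. reflexivity.
Qed.

Lemma pairing_Csum {X : Type} (f : X -> C) (p0 p : C * X) (l : list (C * X)) :
  pairing f (p :: l)
  = Csum (fun j => Cconj (fst (nth j (p :: l) p0)) * f (snd (nth j (p :: l) p0)))%C (length l).
Proof.
  revert p. induction l as [|q l IH]; intros [c x].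
  - simpl. rewrite Csum_0. simpl. ring.
  - change (length (q :: l)) with (S (length l)). rewrite Csum_shift.
    change (pairing f ((c, x) :: q :: l)) with (Cconj c * f x + pairing f (q :: l))%C.
    rewrite IH. reflexivity.
Qed.

Lemma psd_of_PSD_on (rho : R) (k : C -> C -> C) :
  PSD_on rho k -> psd (fun x y : Hr rho => k (proj1_sig x) (proj1_sig y)).
Proof.
  intros H l. unfold formsq. destruct l as [|p l].
  - unfold form; simpl. split; lra.
  (* [quad_form] sums over indices [0..N] inclusive, so [N = length l] matches the list [p :: l].
     The default [p] keeps every [x j] in the half-plane. *)
  - set (c := fun j => fst (nth j (p :: l) p)).
    set (x := fun j => proj1_sig (snd (nth j (p :: l) p))).
    assert (E : form (fun x y : Hr rho => k (proj1_sig x) (proj1_sig y)) (p :: l) (p :: l)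
            = quad_form k (length l) x c).
    { unfold form. rewrite (pairing_Csum _ p). apply Csum_eq. intros i _.
      rewrite (comb_Csum _ p), <- Csum_mult_l. apply Csum_eq. intros j _.
      unfold x, c. ring. }
    rewrite E. apply H. intros i _. exact (proj2_sig (snd (nth i (p :: l) p))).
Qed.

Lemma PSD_on_hermitian (rho : R) (k : C -> C -> C) (s u : C) :
  PSD_on rho k -> inH rho s -> inH rho u -> k u s = Cconj (k s u).
Proof.
  intros H Hs Hu.
  exact (psd_hermitian _ (psd_of_PSD_on rho k H) (exist _ s Hs) (exist _ u Hu)).
Qed.

Lemma PSD_on_diag (rho : R) (k : C -> C -> C) (s : C) :
  PSD_on rho k -> inH rho s -> 0 <= Re (k s s) /\ k s s = RtoC (Re (k s s)).
Proof.
  intros H Hs. pose proof (psd_of_PSD_on rho k H) as Hp.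
  set (t := exist _ s Hs : Hr rho).
  assert (E : formsq (fun x y : Hr rho => k (proj1_sig x) (proj1_sig y)) ((RtoC 1, t) :: nil) = Re (k s s))
    by exact (formsq_single (fun x y : Hr rho => k (proj1_sig x) (proj1_sig y)) t).
  rewrite <- E.
  split; [apply Hp |]. rewrite <- (formsq_real _ _ Hp), form_single. simpl. ring.
Qed.

Lemma PSD_on_cauchy_schwarz (rho : R) (k : C -> C -> C) (s u : C) :
  PSD_on rho k -> inH rho s -> inH rho u ->
  Cmod (k s u) ^ 2 <= Cmod (k s s) * Cmod (k u u).
Proof.
  intros H Hs Hu. pose proof (psd_of_PSD_on rho k H) as Hp.
  destruct (PSD_on_diag rho k s H Hs) as [Hs0 Hs1]. destruct (PSD_on_diag rho k u H Hu) as [Hu0 Hu1].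
  rewrite Hs1, Hu1, !Cmod_R, !Rabs_right by lra.
  pose proof (comb_sqr_le _ ((RtoC 1, exist _ u Hu : Hr rho) :: nil) (exist _ s Hs) Hp) as E.
  rewrite formsq_single in E. simpl in E.
  replace (1 * k s u + 0)%C with (k s u) in E by ring.
  simpl. lra.
Qed.

Lemma filterlim_prod_swap {A B D : Type} (F : (A -> Prop) -> Prop) (G : (B -> Prop) -> Prop)
    (L : (D -> Prop) -> Prop) (f : A -> B -> D) :
  filterlim (fun p => f (fst p) (snd p)) (filter_prod F G) L ->
  filterlim (fun p => f (snd p) (fst p)) (filter_prod G F) L.
Proof.
  intros H P HP. destruct (H P HP) as [Q S HQ HS HQS].
  exists S Q; try assumption. intros x y Hx Hy. exact (HQS y x Hy Hx).
Qed.

Lemma eventually_prod_ge (n m : nat) :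
  filter_prod eventually eventually (fun p : nat * nat => (n <= fst p)%nat /\ (m <= snd p)%nat).
Proof.
  exists (fun i => (n <= i)%nat) (fun i => (m <= i)%nat); [now exists n | now exists m | auto].
Qed.

Lemma dsum_correct (c : nat -> nat -> C) (s u : C) : dconv c s u -> dconv_to c s u (dsum c s u).
Proof.
  intros [l Hl]. unfold dconv_to.
  apply (filterlim_locally (U := C_UniformSpace)). intros eps.
  assert (FF : ProperFilter (filtermap (fun p : nat * nat => dpsum c s u (fst p) (snd p))
      (filter_prod eventually eventually))) by apply filtermap_proper_filter, filter_prod_proper.
  refine (complete_cauchy (T := C_CompleteNormedModule) _ FF _ eps).
  intros d. exists l. exact (proj1 (filterlim_locally (U := C_UniformSpace) _ l) Hl d).
Qed.

(** Pringsheim convergence controls only rectangles large in both directions. The remaining ones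
    involve finitely many rows or finitely many columns, each with bounded partial sums. *)
Lemma double_partial_sums_bounded (c : nat -> nat -> C) (l : C) :
  filterlim (fun p => Csum (fun i => Csum (fun j => c i j) (snd p)) (fst p))
    (filter_prod eventually eventually) (locally l) ->
  (forall i, exists B, forall N, Cmod (Csum (fun j => c i j) N) <= B) ->
  (forall j, exists B, forall M, Cmod (Csum (fun i => c i j) M) <= B) ->
  exists B, forall M N, Cmod (Csum (fun i => Csum (fun j => c i j) N) M) <= B.
Proof.
  intros Hlim Hrow Hcol.
  assert (Hprefix : forall d : nat -> nat -> C,
     (forall i, exists B, forall N, Cmod (Csum (fun j => d i j) N) <= B) ->
     forall M0, exists B, forall M N, (M < M0)%nat -> Cmod (Csum (fun i => Csum (fun j => d i j) N) M) <= B).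
  { intros d Hd.
    assert (H1 : forall M, exists B, forall N, Cmod (Csum (fun i => Csum (fun j => d i j) N) M) <= B).
    { induction M as [|M [B HB]].
      - destruct (Hd 0%nat) as [B HB]. exists B. intros N. rewrite Csum_0. apply HB.
      - destruct (Hd (S M)) as [B' HB']. exists (B + B'). intros N. rewrite Csum_S.
        eapply Rle_trans; [apply Cmod_triangle |]. now apply Rplus_le_compat. }
    induction M0 as [|M0 [B HB]].
    - exists 0. intros; lia.
    - destruct (H1 M0) as [B' HB']. exists (Rmax B B'). intros M N HM.
      destruct (Nat.eq_dec M M0) as [->|].
      + eapply Rle_trans; [apply HB' | apply Rmax_r].
      + eapply Rle_trans; [apply HB; lia | apply Rmax_l]. }
  destruct (proj1 (Clim_eps _ _) Hlim 1 Rlt_0_1) as [Q S [M0 HQ] [N0 HS] HQS].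
  destruct (Hprefix c Hrow M0) as [B1 HB1].
  destruct (Hprefix (fun j i => c i j) Hcol N0) as [B2 HB2].
  exists (Rmax (Rmax B1 B2) (Cmod l + 1)). intros M N.
  destruct (le_lt_dec M0 M) as [HM | HM].
  - destruct (le_lt_dec N0 N) as [HN | HN].
    + eapply Rle_trans; [| apply Rmax_r].
      specialize (HQS M N (HQ M HM) (HS N HN)). simpl in HQS.
      set (x := Csum _ M) in *. replace x with (l + (x - l))%C by ring.
      eapply Rle_trans; [apply Cmod_triangle |]. lra.
    + eapply Rle_trans; [| apply Rmax_l]. eapply Rle_trans; [| apply Rmax_r].
      rewrite (Csum_switch (fun i j => c i j)). now apply HB2.
  - eapply Rle_trans; [| apply Rmax_l]. eapply Rle_trans; [| apply Rmax_l]. now apply HB1.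
Qed.

Lemma dterm_partial_sums_bounded (c : nat -> nat -> C) (s u : C) : reg_conv_at c s u ->
  exists B, forall M N, Cmod (Csum (fun i => Csum (fun j => dterm c s u i j) N) M) <= B.
Proof.
  intros [[l Hl] [Hrow Hcol]].
  apply (double_partial_sums_bounded _ l); [exact Hl | |].
  - intros i. destruct (Hrow (S i) ltac:(lia)) as [r Hr].
    assert (Hr' : filterlim (Csum (fun j => dterm c s u i j)) eventually
              (locally (npow_neg (S i) s * r)%C)).
    { apply filterlim_ext with
        (fun N => npow_neg (S i) s * Csum (fun j => c (S i) (S j) * npow_neg (S j) u)%C N)%C.
      - intros N. rewrite <- Csum_mult_l. apply Csum_eq. intros j _. unfold dterm. ring.
      - apply Clim_mult; [apply Clim_const | exact Hr]. }
    exact (Cseq_bounded _ _ Hr').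
  - intros j. destruct (Hcol (S j) ltac:(lia)) as [r Hr].
    assert (Hr' : filterlim (Csum (fun i => dterm c s u i j)) eventually
              (locally (npow_neg (S j) u * r)%C)).
    { apply filterlim_ext with
        (fun N => npow_neg (S j) u * Csum (fun i => c (S i) (S j) * npow_neg (S i) s)%C N)%C.
      - intros N. rewrite <- Csum_mult_l. apply Csum_eq. intros i _. unfold dterm. ring.
      - apply Clim_mult; [apply Clim_const | exact Hr]. }
    exact (Cseq_bounded _ _ Hr').
Qed.

Lemma le_of_exp_decay (A b K d : R) :
  0 < d -> (forall x, 0 < x -> A <= b + K * exp (- (x * d))) -> A <= b.
Proof.
  intros Hd H. apply Rnot_lt_le. intros Hlt.
  pose proof (Rabs_pos K) as HK.
  (* Since [v exp (- v) <= 1], evaluating at [x = v / d] makes [(|K| + 1) exp (- v)] at most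
     [A - b], a contradiction. *)
  set (v := (Rabs K + 1) / (A - b)).
  assert (Hv : 0 < v) by (apply Rdiv_lt_0_compat; lra).
  specialize (H (v / d) ltac:(now apply Rdiv_lt_0_compat)).
  replace (v / d * d) with v in H by (field; lra).
  pose proof (exp_neg_mult_le v) as He. pose proof (exp_pos (- v)) as Hp.
  pose proof (Rle_abs K).
  assert (Hve : (Rabs K + 1) * exp (- v) <= A - b).
  { replace (Rabs K + 1) with (v * (A - b)) by (unfold v; field; lra). nra. }
  nra.
Qed.

Lemma npow_neg_real_dominated (x : R) : 0 < x ->
  dominated_by (fun i => npow_neg (S i) (RtoC x)) (fun i => exp (- (x * logn i))).
Proof.
  intros Hx. destruct (npow_neg_dominated (RtoC x) Hx) as [H1 H2].
  rewrite Cmod_R, Rabs_right in H1, H2 by lra. simpl in H1, H2.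
  replace (x / x) with 1 in H1, H2 by (field; lra).
  split; intros i; [specialize (H1 i) | specialize (H2 i)]; lra.
Qed.

Definition vanishes_below (n : nat) (c : nat -> nat -> C) : Prop :=
  forall i j, (i < n)%nat \/ (j < n)%nat -> c i j = RtoC 0.

Definition weighted_sum (c : nat -> nat -> C) (z w : C) (M N : nat) : C :=
  Csum (fun i => Csum (fun j => c i j * npow_neg (S i) z * npow_neg (S j) w)%C N) M.

(* By Cauchy-Schwarz [K x y = O(|K x x|^(1/2))] as [x -> +oo], and [K x x] is of smaller order than
   [(n+1)^(-2x)] once [c n n = 0]; but [K x y ~ (n+1)^(-x) sum_j c n j (j+1)^(-y)]. *)
Lemma row_vanishes (c : nat -> nat -> C) (K : R -> R -> C) (B : R) (n : nat) :
  (forall M N, Cmod (Csum (fun i => Csum (fun j => c i j) N) M) <= B) ->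
  vanishes_below n c -> c n n = RtoC 0 ->
  (forall x y, 0 < x -> 0 < y ->
     filterlim (fun p => weighted_sum c (RtoC x) (RtoC y) (fst p) (snd p))
       (filter_prod eventually eventually) (locally (K x y))) ->
  (forall x y, 0 < x -> 0 < y -> Cmod (K x y) ^ 2 <= Cmod (K x x) * Cmod (K y y)) ->
  forall j, c n j = RtoC 0.
Proof.
  intros HB Hv Hnn Hlim Hcs.
  assert (HB0 : 0 <= B) by (eapply Rle_trans; [apply Cmod_ge_0 | apply (HB 0%nat 0%nat)]).
  set (e := fun x i => exp (- (x * logn i))).
  assert (He : forall x i, 0 < e x i) by (intros; apply exp_pos).
  assert (Hrow : forall N, Cmod (Csum (fun j => c n j) N) <= B).
  { intros N. apply row_partial_bound; [exact HB |]. intros i j Hi. apply Hv. now left. }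
  (* The first error comes from the rows after [n], the second from the entries of row [n] after
     column [m]. *)
  assert (Hmain : forall x y m, 0 < x -> 0 < y -> (forall j, (j < m)%nat -> c n j = RtoC 0) ->
     Cmod (K x y - c n m * npow_neg (S m) (RtoC y) * npow_neg (S n) (RtoC x))
       <= 2 * (B * e y n) * e x (S n) + 2 * B * e y (S m) * e x n).
  { intros x y m Hx Hy Hm.
    refine (Clim_Cmod_le _ _ _ (Clim_minus _ _ _ _ (Hlim x y Hx Hy) (Clim_const _)) _).
    generalize (eventually_prod_ge n m). apply filter_imp. intros [M N] [HM HN]. simpl in *.
    pose proof (double_abel_leading c _ _ _ _ B n M N HB Hv
      (npow_neg_real_dominated x Hx) (npow_neg_real_dominated y Hy) HM) as H1.
    pose proof (abel_leading (fun j => c n j) _ _ B m N Hrow Hm (npow_neg_real_dominated y Hy) HN) as H2.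
    cbv beta in H1, H2. fold (e x (S n)) (e y n) in H1. fold (e y (S m)) in H2.
    unfold weighted_sum. set (D := Csum _ M) in *. set (r := Csum _ N) in *.
    replace (D - _)%C with ((D - r * npow_neg (S n) (RtoC x))
       + (r - c n m * npow_neg (S m) (RtoC y)) * npow_neg (S n) (RtoC x))%C by ring.
    eapply Rle_trans; [apply Cmod_triangle |]. apply Rplus_le_compat; [exact H1 |].
    rewrite Cmod_mult, Cmod_npow_neg. simpl. apply Rmult_le_compat_r; [left; apply exp_pos | exact H2]. }
  assert (Hlog : forall i, 0 < logn (S i) - logn i) by (intros i; pose proof (logn_lt i); lra).
  assert (Hstep : forall x i, e x (S i) = e x i * exp (- (x * (logn (S i) - logn i)))).
  { intros x i. unfold e. rewrite <- exp_plus. f_equal. ring. }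
  assert (Hdiag : forall x, 0 < x -> Cmod (K x x) <= 4 * B * (e x n * e x (S n))).
  { intros x Hx. pose proof (Hmain x x n Hx Hx) as H.
    rewrite Hnn in H. replace (K x x - _)%C with (K x x) in H by ring.
    specialize (H ltac:(intros; apply Hv; now right)). lra. }
  assert (Hind : forall m, (forall j, (j < m)%nat -> c n j = RtoC 0) -> c n m = RtoC 0).
  { intros m Hm. apply Cmod_eq_0, Rle_antisym; [| apply Cmod_ge_0].
    (* The limits are nested: for fixed [y] the variable [x] tends to infinity, and [y] follows. *)
    apply (le_of_exp_decay _ 0 (2 * B) _ (Hlog m)). intros y Hy.
    apply Rmult_le_reg_r with (e y m); [apply He |].
    replace ((0 + 2 * B * exp (- (y * (logn (S m) - logn m)))) * e y m) with (2 * B * e y (S m))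
      by (rewrite Hstep; ring).
    set (P := sqrt (4 * B * Cmod (K y y))).
    assert (HP0 : 0 <= P) by apply sqrt_pos.
    assert (HP : P ^ 2 = 4 * B * Cmod (K y y)).
    { apply pow2_sqrt. pose proof (Cmod_ge_0 (K y y)). nra. }
    (* Cauchy-Schwarz takes the square root of the decay of [K x x], so only half the gap of
       logarithms is gained. *)
    assert (Hd2 : 0 < (logn (S n) - logn n) / 2) by (pose proof (Hlog n); lra).
    apply (le_of_exp_decay _ _ (P + 2 * (B * e y n)) _ Hd2).
    intros x Hx.
    set (r := exp (- (x * ((logn (S n) - logn n) / 2)))).
    assert (Hr : 0 < r <= 1).
    { split; [apply exp_pos |]. rewrite <- exp_0. apply exp_le_compat. nra. }
    assert (Hex : e x (S n) = e x n * (r * r)).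
    { rewrite Hstep. f_equal. unfold r. rewrite <- exp_plus. f_equal. field. }
    assert (HK : Cmod (K x y) <= P * (e x n * r)).
    { pose proof (Hcs x y Hx Hy) as H1. pose proof (Hdiag x Hx) as H2. rewrite Hex in H2.
      assert (H3 : Cmod (K x y) ^ 2 <= (P * (e x n * r)) ^ 2).
      { replace ((P * (e x n * r)) ^ 2) with (P ^ 2 * (e x n * (e x n * (r * r)))) by ring.
        rewrite HP. pose proof (Cmod_ge_0 (K y y)).
        apply Rmult_le_compat_r with (r := Cmod (K y y)) in H2; [| assumption]. lra. }
      pose proof (He x n). assert (0 <= P * (e x n * r)) by (apply Rmult_le_pos; nra).
      apply Rnot_lt_le. intros Hn. pose proof (Cmod_ge_0 (K x y)). nra. }
    pose proof (Hmain x y m Hx Hy Hm) as H.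
    assert (Hc : Cmod (c n m) * e y m * e x n <= Cmod (K x y) +
                (2 * (B * e y n) * e x (S n) + 2 * B * e y (S m) * e x n)).
    { replace (Cmod (c n m) * e y m * e x n)
        with (Cmod (c n m * npow_neg (S m) (RtoC y) * npow_neg (S n) (RtoC x)))
        by (rewrite !Cmod_mult, !Cmod_npow_neg; reflexivity).
      set (q := (c n m * npow_neg (S m) (RtoC y) * npow_neg (S n) (RtoC x))%C) in *.
      replace q with (K x y + - (K x y - q))%C at 1 by ring.
      eapply Rle_trans; [apply Cmod_triangle |]. rewrite Cmod_opp. lra. }
    apply Rmult_le_reg_r with (e x n); [apply He |].
    eapply Rle_trans; [exact Hc |]. rewrite Hex.
    assert (HBe : 0 <= B * e y n) by (apply Rmult_le_pos; [exact HB0 | left; apply He]).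
    assert (Hrr : 2 * (B * e y n) * (e x n * (r * r)) <= 2 * (B * e y n) * (e x n * r)).
    { apply Rmult_le_compat_l; [lra |]. apply Rmult_le_compat_l; [left; apply He | nra]. }
    lra. }
  intros j. induction j as [j IH] using lt_wf_ind. now apply Hind.
Qed.

(** If there were no such [n], then [c n n = 0] at every stage, so row [n] and, by transposition,
    column [n] would vanish. Inductively the whole matrix would be 0, against [K 1 1 <> 0]. *)
Lemma leading_coefficient (c : nat -> nat -> C) (K : R -> R -> C) (B : R) :
  (forall M N, Cmod (Csum (fun i => Csum (fun j => c i j) N) M) <= B) ->
  (forall x y, 0 < x -> 0 < y ->
     filterlim (fun p => weighted_sum c (RtoC x) (RtoC y) (fst p) (snd p))
       (filter_prod eventually eventually) (locally (K x y))) ->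
  (forall x y, 0 < x -> 0 < y -> Cmod (K x y) ^ 2 <= Cmod (K x x) * Cmod (K y y)) ->
  K 1 1 <> RtoC 0 ->
  exists n, vanishes_below n c /\ c n n <> RtoC 0.
Proof.
  intros HB Hlim Hcs H11.
  apply NNPP. intros Hno.
  assert (Hall : forall n, vanishes_below n c).
  { induction n as [|n IH].
    - intros i j [H | H]; lia.
    - assert (Hnn : c n n = RtoC 0).
      { apply NNPP. intros Hne. apply Hno. now exists n. }
      assert (Hr : forall j, c n j = RtoC 0) by exact (row_vanishes c K B n HB IH Hnn Hlim Hcs).
      assert (Hc : forall i, c i n = RtoC 0).
      { apply (row_vanishes (fun i j => c j i) (fun x y => K y x) B n).
        - intros M N. rewrite <- (Csum_switch (fun i j => c i j)). apply HB.
        - intros i j H. apply IH. tauto.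
        - exact Hnn.
        - intros x y Hx Hy.
          apply filterlim_ext with
            (fun p => weighted_sum c (RtoC y) (RtoC x) (snd p) (fst p)).
          + intros [M N]. unfold weighted_sum. simpl. rewrite Csum_switch.
            apply Csum_eq. intros i _. apply Csum_eq. intros j _. ring.
          + apply (filterlim_prod_swap eventually eventually _
                     (fun M N => weighted_sum c (RtoC y) (RtoC x) M N)).
            now apply Hlim.
        - intros x y Hx Hy. rewrite (Rmult_comm (Cmod (K x x))). now apply Hcs. }
      intros i j Hij.
      destruct (Nat.eq_dec i n) as [->|]; [apply Hr |].
      destruct (Nat.eq_dec j n) as [->|]; [apply Hc |].
      apply IH. lia. }
  apply H11.
  refine (Clim_unique _ _ _ (Hlim 1 1 Rlt_0_1 Rlt_0_1) _).
  apply filterlim_ext with (fun _ => RtoC 0).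
  - intros [M N]. symmetry. apply Csum_zero. intros i _. apply Csum_zero. intros j _.
    rewrite (Hall (S i) i j) by (left; lia). ring.
  - apply Clim_const.
Qed.

(** * Dilations and rank one *)

Definition dilation (rho alpha : R) (s : C) : C := (RtoC alpha * (s - RtoC rho) + RtoC rho)%C.

Lemma phiA_affine (rho a b : R) (s : C) : 0 < a ->
  phiA rho a b 0 (/ a) s
  = (RtoC (a ^ 2) * (s - RtoC rho) - Ci * RtoC (a * b) + RtoC rho)%C.
Proof.
  intros Ha. unfold phiA.
  assert (Ha' : RtoC a <> RtoC 0) by (intros E; apply RtoC_inj in E; lra).
  rewrite !RtoC_inv, RtoC_mult by lra. rewrite RtoC_pow. field. exact Ha'.
Qed.

Lemma inH_dilation (rho alpha : R) (s : C) : 0 < alpha -> inH rho s -> inH rho (dilation rho alpha s).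
Proof.
  unfold inH, dilation. intros Ha Hs. destruct s as [x y]. simpl in *.
  assert (0 < alpha * (x - rho)) by (apply Rmult_lt_0_compat; lra). lra.
Qed.

Lemma inH_conj (rho : R) (s : C) : inH rho s -> inH rho (Cconj s).
Proof. unfold inH. destruct s; simpl. auto. Qed.

(** Determinant 1 forces [d = 1 / a], so the dilation factor is [a ^ 2]; this is why the squares
    [INR (S k) ^ 2] appear below. *)
Lemma AutLH_dilation (rho a : R) : 0 < a ->
  AutLH rho (phiA rho a 0 0 (/ a)) /\ forall s, phiA rho a 0 0 (/ a) s = dilation rho (a ^ 2) s.
Proof.
  intros Ha. split.
  - exists a, 0, (/ a). split; [field; lra | reflexivity].
  - intros s. rewrite phiA_affine by exact Ha. unfold dilation.
    rewrite Rmult_0_r. ring.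
Qed.

Lemma AutLH_transitive (rho : R) (s t : C) : inH rho s -> inH rho t ->
  exists g, AutLH rho g /\ g s = t.
Proof.
  unfold inH. intros Hs Ht.
  (* The real part of the equation [g s = t] determines [a ^ 2], and its imaginary part then
     determines [b]. *)
  set (a := sqrt ((Re t - rho) / (Re s - rho))).
  assert (Hq : 0 < (Re t - rho) / (Re s - rho)) by (apply Rdiv_lt_0_compat; lra).
  assert (Ha : 0 < a) by now apply sqrt_lt_R0.
  assert (Ha2 : a ^ 2 = (Re t - rho) / (Re s - rho)) by (apply pow2_sqrt; lra).
  set (b := (a ^ 2 * Im s - Im t) / a).
  exists (phiA rho a b 0 (/ a)). split.
  - exists a, b, (/ a). split; [field; lra | reflexivity].
  - rewrite phiA_affine by exact Ha.
    replace (a * b) with (a ^ 2 * Im s - Im t) by (unfold b; field; lra).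
    rewrite Ha2. destruct s as [x y], t as [x' y']. simpl in *.
    unfold Cplus, Cminus, Cmult, Copp, RtoC, Ci; simpl. f_equal; field; lra.
Qed.

Lemma exp_neg_sqr_nat_lim (d : R) : 0 < d ->
  filterlim (fun k => exp (- (INR (S k) ^ 2 * d))) eventually (locally 0).
Proof.
  intros Hd. apply filterlim_locally. intros eps.
  destruct (INR_unbounded (/ (d * eps))) as [N HN].
  pose proof (cond_pos eps) as Heps. assert (Hde : 0 < d * eps) by now apply Rmult_lt_0_compat.
  exists N. intros k Hk.
  unfold ball; simpl; unfold AbsRing_ball, abs, minus, plus, opp; simpl.
  change (match k with 0%nat => 1 | S _ => INR k + 1 end) with (INR (S k)).
  rewrite Ropp_0, Rplus_0_r, Rabs_right by (left; apply exp_pos).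
  assert (HS : / (d * eps) < INR (S k)).
  { eapply Rlt_le_trans; [exact HN |]. apply le_INR. lia. }
  assert (HS1 : 1 <= INR (S k)) by (apply (le_INR 1); lia).
  set (n := INR (S k)) in *. set (v := n ^ 2 * d).
  assert (Hv : / eps < v).
  { apply Rmult_lt_compat_l with (r := d) in HS; [| exact Hd].
    replace (d * / (d * eps)) with (/ eps) in HS by (field; lra). unfold v.
    assert (0 <= (n - 1) * (d * n)) by (apply Rmult_le_pos; nra). lra. }
  assert (Hv0 : 0 < / eps) by now apply Rinv_0_lt_compat.
  replace (n * (n * 1) * d) with v by (unfold v; ring).
  pose proof (exp_neg_mult_le v) as H. pose proof (exp_pos (- v)).
  apply Rmult_lt_reg_l with (/ eps); [exact Hv0 |]. rewrite Rinv_l by lra.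
  apply Rlt_le_trans with (v * exp (- v)); [now apply Rmult_lt_compat_r | exact H].
Qed.

(** The powers at [rho + 1] are moved into the coefficients, whose rectangular sums are then
    bounded; only the shifted exponents remain as Abel weights. *)
Lemma kappa_weighted_lim (rho : R) (a : nat -> nat -> C) (s u : C) :
  DirichletKernel rho a -> inH rho s -> inH rho u ->
  filterlim (fun p => weighted_sum (fun i j => dterm a (RtoC (rho + 1)) (RtoC (rho + 1)) i j)
                (s - RtoC (rho + 1)) (Cconj u - RtoC (rho + 1)) (fst p) (snd p))
    (filter_prod eventually eventually) (locally (kappa a s u)).
Proof.
  intros H Hs Hu.
  apply filterlim_ext with (fun p : nat * nat => dpsum a s (Cconj u) (fst p) (snd p)).
  - intros [M N]. apply Csum_eq. intros i _. apply Csum_eq. intros j _. simpl.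
    unfold dterm. set (r := RtoC (rho + 1)).
    replace s with (r + (s - r))%C at 1 by ring.
    replace (Cconj u) with (r + (Cconj u - r))%C at 1 by ring.
    rewrite !npow_neg_plus. ring.
  - exact (dsum_correct a s (Cconj u) (proj1 (H s (Cconj u) Hs (inH_conj rho u Hu)))).
Qed.

(* [Cmod z / Re z] stays bounded along dilations because they preserve angular sectors at [rho]. *)
Lemma dilation_sector (rho alpha : R) (s : C) : inH rho s -> 2 <= alpha * (Re s - rho) ->
  let z := (dilation rho alpha s - RtoC (rho + 1))%C in
  alpha * ((Re s - rho) / 2) <= Re z /\
  Cmod z / Re z <= 4 * Cmod (s - RtoC rho) / (Re s - rho).
Proof.
  intros Hs Ha z. unfold inH in Hs.
  assert (Ha0 : 0 < alpha).
  { apply Rnot_le_lt. intros Hn. assert (alpha * (Re s - rho) <= 0) by nra. lra. }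
  (* The threshold 2 ensures that the shift by 1 at most halves the real part, and it at most
     doubles the modulus; together they give the constant 4. *)
  assert (Hz : Re z = alpha * (Re s - rho) - 1).
  { unfold z, dilation. destruct s; simpl. ring. }
  split; [rewrite Hz; lra |].
  assert (Hm : Re s - rho <= Cmod (s - RtoC rho)).
  { eapply Rle_trans; [| apply re_le_Cmod]. eapply Rle_trans; [| apply Rle_abs].
    destruct s; simpl. lra. }
  assert (Hzm : Cmod z <= 2 * (alpha * Cmod (s - RtoC rho))).
  { replace z with (RtoC alpha * (s - RtoC rho) + - RtoC 1)%C
      by (unfold z, dilation; rewrite RtoC_plus; ring).
    eapply Rle_trans; [apply Cmod_triangle |].
    rewrite Cmod_opp, Cmod_1, Cmod_mult, Cmod_R, Rabs_right by lra. nra. }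
  apply Rmult_le_reg_r with (Re z); [lra |].
  replace (Cmod z / Re z * Re z) with (Cmod z) by (field; lra).
  eapply Rle_trans; [exact Hzm |].
  replace (2 * (alpha * Cmod (s - RtoC rho)))
    with (4 * Cmod (s - RtoC rho) / (Re s - rho) * (alpha * ((Re s - rho) / 2))) by (field; lra).
  apply Rmult_le_compat_l; [| rewrite Hz; lra].
  apply Rdiv_le_0_compat; lra.
Qed.

Lemma kappa_leading_term (rho : R) (a : nat -> nat -> C) (n : nat) (s u : C) :
  let r := RtoC (rho + 1) in
  let c := fun i j => dterm a r r i j in
  let E := fun k s => npow_neg (S n) (dilation rho (INR (S k) ^ 2) s - r) in
  DirichletKernel rho a -> vanishes_below n c -> inH rho s -> inH rho u ->
  filterlim (fun k => kappa a (dilation rho (INR (S k) ^ 2) s) (dilation rho (INR (S k) ^ 2) u)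
                / (E k s * E k (Cconj u)))%C
    eventually (locally (c n n)).
Proof.
  intros r c E Hk Hv Hs Hu.
  assert (Hr : inH rho r) by (unfold inH, r; simpl; lra).
  destruct (dterm_partial_sums_bounded a r r (Hk r r Hr Hr)) as [B HB].
  assert (HB0 : 0 <= B) by (eapply Rle_trans; [apply Cmod_ge_0 | apply (HB 0%nat 0%nat)]).
  set (ps := (Re s - rho) / 2). set (pu := (Re u - rho) / 2).
  set (Ks := 4 * Cmod (s - RtoC rho) / (Re s - rho)).
  set (Ku := 4 * Cmod (Cconj u - RtoC rho) / (Re u - rho)).
  assert (Hps : 0 < ps) by (unfold ps, inH in *; lra).
  assert (Hpu : 0 < pu) by (unfold pu, inH in *; lra).
  assert (HKs : 0 <= Ks).
  { unfold Ks, inH in *. pose proof (Cmod_ge_0 (s - RtoC rho)). apply Rdiv_le_0_compat; lra. }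
  assert (HKu : 0 <= Ku).
  { unfold Ku, inH in *. pose proof (Cmod_ge_0 (Cconj u - RtoC rho)). apply Rdiv_le_0_compat; lra. }
  set (delta := logn (S n) - logn n).
  assert (Hdelta : 0 < delta) by (unfold delta; pose proof (logn_lt n); lra).
  apply Clim_squeeze with (fun k =>
     (2 * B * Ku * Ks) * exp (- (INR (S k) ^ 2 * (ps * delta)))
     + (2 * B * Ku) * exp (- (INR (S k) ^ 2 * (pu * delta)))).
  2: { change 0 with (real (Finite 0)).
       replace (Finite 0) with (Finite ((2 * B * Ku * Ks) * 0 + (2 * B * Ku) * 0)) by (f_equal; ring).
       apply is_lim_seq_plus'.
       - apply (is_lim_seq_scal_l _ _ (Finite 0)). apply exp_neg_sqr_nat_lim. now apply Rmult_lt_0_compat.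
       - apply (is_lim_seq_scal_l _ _ (Finite 0)). apply exp_neg_sqr_nat_lim. now apply Rmult_lt_0_compat. }
  (* From here on [al * ps] and [al * pu] are at least 1, which is the threshold of
     [dilation_sector] for both points. *)
  destruct (INR_unbounded (/ ps + / pu)) as [N HN]. exists N. intros k Hk'.
  set (al := INR (S k) ^ 2).
  assert (Hal : / ps + / pu <= al).
  { assert (INR N <= INR (S k)) by (apply le_INR; lia).
    assert (1 <= INR (S k)) by (apply (le_INR 1); lia). unfold al. nra. }
  pose proof (Rinv_0_lt_compat _ Hps) as Hips. pose proof (Rinv_0_lt_compat _ Hpu) as Hipu.
  assert (Has : 1 <= al * ps).
  { apply Rle_trans with (/ ps * ps); [rewrite Rinv_l; lra |]. apply Rmult_le_compat_r; lra. }
  assert (Hau : 1 <= al * pu).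
  { apply Rle_trans with (/ pu * pu); [rewrite Rinv_l; lra |]. apply Rmult_le_compat_r; lra. }
  assert (Hal0 : 0 < al) by lra.
  set (z := (dilation rho al s - r)%C). set (w := (dilation rho al (Cconj u) - r)%C).
  (* Dilations have real parameters and commute with conjugation, so the sector bound for [Cconj u]
     applies to the second exponent. *)
  assert (Hw : w = (Cconj (dilation rho al u) - r)%C).
  { unfold w, dilation. rewrite Cplus_conj, Cmult_conj, Cminus_conj, !Cconj_RtoC. reflexivity. }
  destruct (dilation_sector rho al s Hs) as [Hz1 Hz2]; [unfold ps in Has; lra |].
  destruct (dilation_sector rho al (Cconj u) (inH_conj _ _ Hu)) as [Hw1 Hw2];
    [unfold pu in Hau; destruct u; simpl in *; lra |].
  fold r z in Hz1, Hz2. fold r w in Hw1, Hw2. fold ps Ks in Hz1, Hz2.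
  replace (Re (Cconj u)) with (Re u) in Hw1, Hw2 by (destruct u; reflexivity).
  fold pu Ku in Hw1, Hw2.
  assert (Hzp : 0 < Re z) by lra. assert (Hwp : 0 < Re w) by lra.
  set (ez := exp (- (Re z * logn n))). set (ew := exp (- (Re w * logn n))).
  assert (Hez : 0 < ez) by apply exp_pos. assert (Hew : 0 < ew) by apply exp_pos.
  assert (Hstep : forall x, exp (- (x * logn (S n))) = exp (- (x * logn n)) * exp (- (x * delta))).
  { intros x. rewrite <- exp_plus. f_equal. unfold delta. ring. }
  set (kv := kappa a (dilation rho al s) (dilation rho al u)).
  assert (Hbound : Cmod (kv - c n n * npow_neg (S n) w * npow_neg (S n) z)
     <= 2 * (B * (Ku * ew)) * (Ks * (ez * exp (- (Re z * delta))))
        + 2 * B * (Ku * (ew * exp (- (Re w * delta)))) * ez).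
  { pose proof (kappa_weighted_lim rho a _ _ Hk (inH_dilation rho al s Hal0 Hs)
                  (inH_dilation rho al u Hal0 Hu)) as Hlim.
    fold r kv in Hlim. rewrite <- Hw in Hlim. fold z c in Hlim.
    refine (Clim_Cmod_le _ _ _ (Clim_minus _ _ _ _ Hlim (Clim_const _)) _).
    generalize (eventually_prod_ge n n). apply filter_imp. intros [M N'] [HM HN']. simpl in HM, HN'.
    cbn [fst snd].
    assert (Hrow : forall N, Cmod (Csum (fun j => c n j) N) <= B).
    { intros N0. apply row_partial_bound; [exact HB |]. intros i j Hi. apply Hv. now left. }
    assert (Hrow0 : forall j, (j < n)%nat -> c n j = RtoC 0) by (intros j Hj; apply Hv; now right).
    pose proof (double_abel_leading c _ _ _ _ B n M N' HB Hv
      (npow_neg_dominated z Hzp) (npow_neg_dominated w Hwp) HM) as H1.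
    pose proof (abel_leading (fun j => c n j) _ _ B n N' Hrow Hrow0 (npow_neg_dominated w Hwp) HN') as H2.
    cbv beta in H1, H2. rewrite Hstep in H1, H2. fold ew ez in H1, H2.
    unfold weighted_sum. set (D := Csum _ M) in *. set (q := Csum _ N') in *.
    replace (D - _)%C with ((D - q * npow_neg (S n) z)
       + (q - c n n * npow_neg (S n) w) * npow_neg (S n) z)%C by ring.
    eapply Rle_trans; [apply Cmod_triangle |]. apply Rplus_le_compat.
    - eapply Rle_trans; [exact H1 |].
      pose proof (exp_pos (- (Re z * delta))).
      assert (0 <= Cmod z / Re z) by (apply Rdiv_le_0_compat; [apply Cmod_ge_0 | exact Hzp]).
      assert (0 <= Cmod w / Re w) by (apply Rdiv_le_0_compat; [apply Cmod_ge_0 | exact Hwp]).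
      apply Rmult_le_compat.
      + apply Rmult_le_pos; [lra |]. apply Rmult_le_pos; [lra |]. apply Rmult_le_pos; lra.
      + apply Rmult_le_pos; [lra |]. apply Rmult_le_pos; lra.
      + apply Rmult_le_compat_l; [lra |]. apply Rmult_le_compat_l; [lra |].
        apply Rmult_le_compat_r; lra.
      + apply Rmult_le_compat_r; [apply Rmult_le_pos; lra | exact Hz2].
    - rewrite Cmod_mult, Cmod_npow_neg. fold ez. apply Rmult_le_compat_r; [lra |].
      eapply Rle_trans; [exact H2 |]. pose proof (exp_pos (- (Re w * delta))).
      apply Rmult_le_compat_l; [lra |]. apply Rmult_le_compat_r; [apply Rmult_le_pos; lra | exact Hw2]. }
  change (Cmod (kv / (npow_neg (S n) z * npow_neg (S n) w) - c n n)%C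
     <= 2 * B * Ku * Ks * exp (- (al * (ps * delta))) + 2 * B * Ku * exp (- (al * (pu * delta)))).
  pose proof (npow_neg_nz n z) as Hnz. pose proof (npow_neg_nz n w) as Hnw.
  replace (kv / (npow_neg (S n) z * npow_neg (S n) w) - c n n)%C
    with ((kv - c n n * npow_neg (S n) w * npow_neg (S n) z)
            / (npow_neg (S n) z * npow_neg (S n) w))%C by (field; auto).
  rewrite Cmod_div by (apply Cmult_neq_0; assumption).
  rewrite Cmod_mult, !Cmod_npow_neg. fold ez ew.
  apply Rmult_le_reg_r with (ez * ew); [nra |].
  set (num := Cmod (kv - c n n * npow_neg (S n) w * npow_neg (S n) z)) in *. replace (num / (ez * ew) * (ez * ew)) with num by (field; lra).
  eapply Rle_trans; [exact Hbound |].
  assert (X1 : exp (- (Re z * delta)) <= exp (- (al * (ps * delta)))) by (apply exp_le_compat;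
    pose proof (Rmult_le_compat_r delta _ _ (Rlt_le _ _ Hdelta) Hz1); lra).
  assert (X2 : exp (- (Re w * delta)) <= exp (- (al * (pu * delta)))) by (apply exp_le_compat;
    pose proof (Rmult_le_compat_r delta _ _ (Rlt_le _ _ Hdelta) Hw1); lra).
  assert (Y1 : 0 <= 2 * B * Ku * Ks * (ez * ew)).
  { repeat (apply Rmult_le_pos; [| assumption || (apply Rmult_le_pos; lra)]). lra. }
  assert (Y2 : 0 <= 2 * B * Ku * (ez * ew)).
  { repeat (apply Rmult_le_pos; [| assumption || (apply Rmult_le_pos; lra)]). lra. }
  apply Rmult_le_compat_l with (r := 2 * B * Ku * Ks * (ez * ew)) in X1; [| exact Y1].
  apply Rmult_le_compat_l with (r := 2 * B * Ku * (ez * ew)) in X2; [| exact Y2].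
  lra.
Qed.

(* After dilating by [INR (S k) ^ 2], quasi-invariance makes both sides equal up to
   leading terms that agree in the limit. *)
Lemma kappa_rank_one (rho : R) (a : nat -> nat -> C) (J : (C -> C) -> C -> C) (s u t : C) :
  DirichletKernel rho a -> QuasiInvariant rho (AutLH rho) J (kappa a) ->
  (forall s, inH rho s -> kappa a s s <> RtoC 0) ->
  inH rho s -> inH rho u -> inH rho t ->
  (kappa a s u * kappa a t t = kappa a s t * kappa a t u)%C.
Proof.
  intros Hk [HP [_ HJ]] Hdiag Hs Hu Ht.
  set (r := RtoC (rho + 1)). set (c := fun i j => dterm a r r i j).
  assert (Hr : inH rho r) by (unfold inH, r; simpl; lra).
  assert (Hreal : forall x, 0 < x -> inH rho (r + RtoC x)%C) by (intros x Hx; unfold inH, r; simpl; lra).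
  destruct (dterm_partial_sums_bounded a r r (Hk r r Hr Hr)) as [B HB].
  destruct (leading_coefficient c (fun x y => kappa a (r + RtoC x)%C (r + RtoC y)%C) B)
    as [n [Hv Hn]].
  - exact HB.
  - intros x y Hx Hy.
    pose proof (kappa_weighted_lim rho a _ _ Hk (Hreal x Hx) (Hreal y Hy)) as H.
    fold r c in H.
    replace (r + RtoC x - r)%C with (RtoC x) in H by ring.
    replace (Cconj (r + RtoC y) - r)%C with (RtoC y) in H
      by (unfold r; rewrite Cplus_conj, !Cconj_RtoC; ring).
    exact H.
  - intros x y Hx Hy. apply (PSD_on_cauchy_schwarz rho); auto.
  - apply Hdiag, Hreal, Rlt_0_1.
  - set (g := fun k => dilation rho (INR (S k) ^ 2)).
    set (E := fun k s => npow_neg (S n) (dilation rho (INR (S k) ^ 2) s - r)).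
    set (q := fun x y k => (kappa a (g k x) (g k y) / (E k x * E k (Cconj y)))%C).
    assert (Hq : forall x y, inH rho x -> inH rho y ->
        filterlim (q x y) eventually (locally (c n n))).
    { intros x y Hx Hy. exact (kappa_leading_term rho a n x y Hk Hv Hx Hy). }
    assert (Hkq : forall x y k, kappa a (g k x) (g k y) = (q x y k * (E k x * E k (Cconj y)))%C).
    { intros x y k. unfold q. field.
      split; apply npow_neg_nz. }
    assert (Heq : forall k, (kappa a s u * kappa a t t * (q s t k * q t u k)
                    = kappa a s t * kappa a t u * (q s u k * q t t k))%C).
    (* On each side [s] and [t] occur once as first argument, [u] and [t] once as second, so all
       factors [J] and [E] agree after substitution. *)
    { intros k.
      assert (Hpos : 0 < INR (S k)) by (apply lt_0_INR; lia).
      destruct (AutLH_dilation rho (INR (S k)) Hpos) as [HA Hg].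
      set (h := phiA rho (INR (S k)) 0 0 (/ INR (S k))) in *.
      assert (Hinv : forall x y, inH rho x -> inH rho y ->
         kappa a x y = (J h x * (q x y k * (E k x * E k (Cconj y))) * Cconj (J h y))%C).
      { intros x y Hx Hy. rewrite <- Hkq. unfold g. rewrite <- !Hg. symmetry. now apply HJ. }
      rewrite (Hinv s u), (Hinv t t), (Hinv s t), (Hinv t u) by assumption. ring. }
    assert (Hlim : (kappa a s u * kappa a t t * (c n n * c n n)
                    = kappa a s t * kappa a t u * (c n n * c n n))%C).
    { refine (Clim_unique (F := eventually)
        (fun k => kappa a s u * kappa a t t * (q s t k * q t u k))%C _ _ _ _).
      - apply Clim_mult; [apply Clim_const | apply Clim_mult; now apply Hq].
      - apply filterlim_ext with (fun k => kappa a s t * kappa a t u * (q s u k * q t t k))%C.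
        + intros k. symmetry. apply Heq.
        + apply Clim_mult; [apply Clim_const | apply Clim_mult; now apply Hq]. }
    assert (Hcc : (c n n * c n n)%C <> RtoC 0) by now apply Cmult_neq_0.
    set (p := (c n n * c n n)%C) in *.
    replace (kappa a s u * kappa a t t)%C with (kappa a s u * kappa a t t * p / p)%C by (field; auto).
    rewrite Hlim. field; auto.
Qed.

(** The coefficients are the row sums at [Cconj t], which do not depend on [s]. The double limit
    together with convergence of each row yields the iterated limit. *)
Lemma DirichletOn_kappa_section (rho : R) (a : nat -> nat -> C) (t : C) (z : C) :
  DirichletKernel rho a -> inH rho t ->
  exists b, DirichletOn rho b (fun s => kappa a s t * z)%C.
Proof.
  intros Hk Ht.
  assert (Ht' : inH rho (Cconj t)) by now apply inH_conj.
  assert (Hrows : forall m, exists r : C, (1 <= m)%nat ->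
     is_series (V := C_NormedModule) (fun j => Cmult (a m (S j)) (npow_neg (S j) (Cconj t))) r).
  { intros m. destruct (le_lt_dec 1 m) as [Hm | Hm].
    - destruct (Hk _ _ Ht' Ht') as [_ [H _]]. destruct (H m Hm) as [r Hr]. now exists r.
    - exists (RtoC 0). lia. }
  destruct (choice _ Hrows) as [b Hb].
  exists (fun m => b m * z)%C. intros s Hs.
  assert (Hpart : forall M, filterlim (fun N => dpsum a s (Cconj t) M N) eventually
       (locally (Csum (fun i => b (S i) * npow_neg (S i) s)%C M))).
  { assert (Hrow : forall i, filterlim (fun N => Csum (fun j => dterm a s (Cconj t) i j) N) eventually
        (locally (b (S i) * npow_neg (S i) s)%C)).
    { intros i. apply filterlim_ext with
        (fun N => Csum (fun j => a (S i) (S j) * npow_neg (S j) (Cconj t))%C N * npow_neg (S i) s)%C.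
      - intros N. rewrite <- Csum_mult_r. apply Csum_eq. intros j _. unfold dterm. ring.
      - apply Clim_mult; [exact (Hb (S i) ltac:(lia)) | apply Clim_const]. }
    induction M as [|M IH].
    - rewrite Csum_0. apply filterlim_ext with (fun N => Csum (fun j => dterm a s (Cconj t) 0 j) N).
      + intros N. symmetry. apply Csum_0.
      + apply Hrow.
    - rewrite Csum_S.
      apply filterlim_ext with
        (fun N => dpsum a s (Cconj t) M N + Csum (fun j => dterm a s (Cconj t) (S M) j) N)%C.
      + intros N. symmetry. apply Csum_S.
      + apply Clim_plus; [exact IH | apply Hrow]. }
  pose proof (dsum_correct a s (Cconj t) (proj1 (Hk s (Cconj t) Hs Ht'))) as Hlim.
  change (filterlim (Csum (dir_term (fun m => b m * z)%C s)) eventually (locally (kappa a s t * z)%C)).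
  apply filterlim_ext with (fun M => Csum (fun i => b (S i) * npow_neg (S i) s)%C M * z)%C.
  { intros M. rewrite <- Csum_mult_r. apply Csum_eq. intros i _. unfold dir_term. ring. }
  apply Clim_mult; [| apply Clim_const].
  apply Clim_eps. intros eps Heps.
  destruct (proj1 (Clim_eps _ _) Hlim (eps / 2) ltac:(lra)) as [Q S [M0 HQ] [N0 HS] HQS].
  (* With [M] fixed beyond [M0], letting [N] tend to infinity replaces the rectangle by the sum of
     the first full rows and keeps the bound [eps / 2]. *)
  exists M0. intros M HM. apply Rle_lt_trans with (eps / 2); [| lra].
  refine (Clim_Cmod_le (F := eventually) _ _ _
            (Clim_minus _ _ _ _ (Hpart M) (Clim_const (kappa a s t))) _).
  exists N0. intros N HN. left. exact (HQS M N (HQ M HM) (HS N HN)).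
Qed.

Lemma DirichletOn_zero (rho : R) : DirichletOn rho (fun _ => RtoC 0) (fun _ => RtoC 0).
Proof.
  intros s _.
  change (filterlim (Csum (dir_term (fun _ => RtoC 0) s)) eventually (locally (RtoC 0))).
  apply filterlim_ext with (fun _ => RtoC 0).
  - intros N. symmetry. apply Csum_zero. intros i _. unfold dir_term. ring.
  - apply Clim_const.
Qed.

Definition rank_one_dirichlet (rho : R) (k : C -> C -> C) : Prop :=
  exists (b : nat -> C) (f : C -> C),
    DirichletOn rho b f /\
    (forall s u, inH rho s -> inH rho u -> k s u = Cmult (f s) (Cconj (f u))) /\
    ((forall s, inH rho s -> f s = RtoC 0) \/ (forall s, inH rho s -> f s <> RtoC 0)).

(** The case split is on the diagonal. One zero of [kappa a s s] spreads to the whole diagonal by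
    transitivity, and Cauchy-Schwarz then kills the kernel; otherwise [kappa_rank_one] applies with
    base point [rho + 1]. *)
Lemma rank_one_of_quasi_invariant (rho : R) (a : nat -> nat -> C) (J : (C -> C) -> C -> C) :
  DirichletKernel rho a -> QuasiInvariant rho (AutLH rho) J (kappa a) ->
  rank_one_dirichlet rho (kappa a).
Proof.
  intros Hk HQ. pose proof HQ as [HP [_ HJ]].
  destruct (classic (forall s, inH rho s -> kappa a s s <> RtoC 0)) as [Hdiag | Hz].
  - set (t := RtoC (rho + 1)).
    assert (Ht : inH rho t) by (unfold inH, t; simpl; lra).
    destruct (PSD_on_diag rho (kappa a) t HP Ht) as [Hp0 Hp].
    set (p := Re (kappa a t t)) in *.
    assert (Hpp : 0 < p).
    { destruct (Rle_lt_or_eq_dec _ _ Hp0) as [H | H]; [exact H |].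
      exfalso. apply (Hdiag t Ht). now rewrite Hp, <- H. }
    assert (Hq : 0 < sqrt p) by now apply sqrt_lt_R0.
    destruct (DirichletOn_kappa_section rho a t (RtoC (/ sqrt p)) Hk Ht) as [b Hb].
    assert (Hf : forall s u, inH rho s -> inH rho u ->
       kappa a s u = (kappa a s t * RtoC (/ sqrt p) * Cconj (kappa a u t * RtoC (/ sqrt p)))%C).
    { intros s u Hs Hu. pose proof (kappa_rank_one rho a J s u t Hk HQ Hdiag Hs Hu Ht) as H.
      rewrite Cmult_conj, Cconj_RtoC, <- (PSD_on_hermitian rho (kappa a) u t HP Hu Ht).
      assert (Hpc : RtoC p <> RtoC 0) by (intros X; apply RtoC_inj in X; lra).
      assert (Hs2 : (RtoC (/ sqrt p) * RtoC (/ sqrt p) = / RtoC p)%C).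
      { rewrite <- RtoC_mult, <- Rinv_mult, sqrt_sqrt by lra. apply RtoC_inv. lra. }
      replace (kappa a s t * RtoC (/ sqrt p) * (kappa a t u * RtoC (/ sqrt p)))%C
        with ((kappa a s t * kappa a t u) * (RtoC (/ sqrt p) * RtoC (/ sqrt p)))%C by ring.
      rewrite <- H, Hs2, Hp. field. exact Hpc. }
    exists b, (fun s => kappa a s t * RtoC (/ sqrt p))%C.
    split; [exact Hb |]. split; [exact Hf |]. right. intros s Hs H0.
    apply (Hdiag s Hs). rewrite (Hf s s Hs Hs), H0. ring.
  - apply not_all_ex_not in Hz. destruct Hz as [s0 Hz].
    apply imply_to_and in Hz. destruct Hz as [Hs0 Hz]. apply NNPP in Hz.
    assert (Hdiag : forall s, inH rho s -> kappa a s s = RtoC 0).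
    { intros s Hs. destruct (AutLH_transitive rho s s0 Hs Hs0) as [g [Hg Hgs]].
      rewrite <- (HJ g s s Hg Hs Hs), Hgs, Hz. ring. }
    exists (fun _ => RtoC 0), (fun _ => RtoC 0).
    split; [apply DirichletOn_zero |]. split; [| now left].
    intros s u Hs Hu. rewrite Cmult_0_l. apply Cmod_eq_0.
    pose proof (PSD_on_cauchy_schwarz rho (kappa a) s u HP Hs Hu) as H.
    rewrite (Hdiag s Hs), Cmod_0, Rmult_0_l in H. pose proof (Cmod_ge_0 (kappa a s u)). nra.
Qed.

(** * Automorphisms of the half-plane and holomorphic multipliers *)

(* The two canonical normed-module structures of [C] over itself share norm and scaling. *)
Lemma is_derive_C_AbsRing (f : C -> C) (s l : C) :
  @is_derive C_AbsRing C_NormedModule f s l <->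
  @is_derive C_AbsRing (AbsRing_NormedModule C_AbsRing) f s l.
Proof.
  split; intros [_ H]; (split; [apply is_linear_scal_l | exact H]).
Qed.

(** The remainder is exactly [h^2 / ((z + h) z^2)], and [|z + h| >= |z| / 2] for
    [|h| <= |z| / 2]. *)
Lemma Cinv_derive (z : C) : z <> RtoC 0 ->
  @is_derive C_AbsRing C_NormedModule Cinv z (- (/ z * / z))%C.
Proof.
  intros Hz. assert (Hm : 0 < Cmod z) by now apply Cmod_gt_0.
  apply (is_derive_of_quadratic_remainder Cinv z _ (2 / Cmod z ^ 3) (Cmod z / 2)); [lra |].
  intros h Hh.
  assert (Hzh : Cmod z / 2 <= Cmod (z + h)).
  { pose proof (Cmod_triangle (z + h) (- h)) as H. rewrite Cmod_opp in H.
    replace (z + h + - h)%C with z in H by ring. lra. }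
  assert (Hnz : (z + h)%C <> RtoC 0) by (apply Cmod_gt_0; lra).
  replace (/ (z + h) - / z - h * - (/ z * / z))%C with (h * h / ((z + h) * (z * z)))%C
    by (field; auto).
  rewrite Cmod_div, !Cmod_mult by (repeat apply Cmult_neq_0; assumption).
  replace (Cmod h * Cmod h) with (Cmod h ^ 2) by ring.
  unfold Rdiv. rewrite Rmult_comm. apply Rmult_le_compat_r; [apply pow2_ge_0 |].
  replace (2 * / Cmod z ^ 3) with (/ (Cmod z / 2 * (Cmod z * Cmod z))) by (field; lra).
  apply Rinv_le_contravar; [repeat apply Rmult_lt_0_compat; lra |]. apply Rmult_le_compat_r; [nra | exact Hzh].
Qed.

(** The imaginary part is [c (Re s - rho)], so a zero forces [c = 0], hence [d = 0], against
    determinant 1. *)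
Lemma phiA_denominator_nz (rho a b c d : R) (s : C) : a * d - b * c = 1 -> inH rho s ->
  (Ci * RtoC c * (s - RtoC rho) + RtoC d)%C <> RtoC 0.
Proof.
  unfold inH. intros Hdet Hs H.
  destruct s as [x y]. unfold Cmult, Cminus, Cplus, Copp, Ci, RtoC in H; simpl in *.
  injection H. intros H1 H2.
  assert (c * (x - rho) = 0) by lra.
  assert (c = 0) by (apply Rmult_integral in H0; destruct H0; lra).
  subst c. assert (d = 0) by lra. subst d. lra.
Qed.

(** With denominator [D], the distance to the boundary is divided by [|D|^2]: the numerator times
    [Cconj D] has real part [(Re s - rho) (a d - b c)]. *)
Lemma inH_phiA (rho a b c d : R) (s : C) : a * d - b * c = 1 -> inH rho s ->
  inH rho (phiA rho a b c d s).
Proof.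
  intros Hdet Hs. pose proof (phiA_denominator_nz rho a b c d s Hdet Hs) as Hnz.
  unfold inH in *. unfold phiA.
  set (D := (Ci * RtoC c * (s - RtoC rho) + RtoC d)%C) in *.
  set (N := (RtoC a * (s - RtoC rho) - Ci * RtoC b)%C).
  assert (Hpos : 0 < Cmod D ^ 2) by (apply pow_lt; now apply Cmod_gt_0).
  assert (E : (N / D)%C = (RtoC (/ Cmod D ^ 2) * (N * Cconj D))%C).
  { rewrite RtoC_inv, <- Cmod_sqr_conj by lra. field. split; [| exact Hnz].
    intros H. apply Hnz. rewrite <- (Cconj_conj D), H. apply Cconj_RtoC. }
  rewrite E.
  assert (HR : Re (N * Cconj D) = Re s - rho).
  { replace (Re s - rho) with ((Re s - rho) * (a * d - b * c)) by (rewrite Hdet; ring).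
    unfold N, D. destruct s as [x y]. simpl. ring. }
  replace (Re (RtoC (/ Cmod D ^ 2) * (N * Cconj D) + RtoC rho))
    with (/ Cmod D ^ 2 * Re (N * Cconj D) + rho).
  - rewrite HR. assert (0 < / Cmod D ^ 2 * (Re s - rho)).
    { apply Rmult_lt_0_compat; [now apply Rinv_0_lt_compat | lra]. } lra.
  - generalize (N * Cconj D)%C. intros [x y]. simpl. ring.
Qed.

Lemma phiA_derive (rho a b c d : R) (s : C) : a * d - b * c = 1 -> inH rho s ->
  exists l, @is_derive C_AbsRing C_NormedModule (phiA rho a b c d) s l.
Proof.
  intros Hdet Hs. pose proof (phiA_denominator_nz rho a b c d s Hdet Hs) as Hnz.
  assert (Haff : forall p q : C, @is_derive C_AbsRing C_NormedModule
             (fun z => (p * (z - RtoC rho) + q)%C) s p).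
  { intros p q.
    apply (is_derive_of_quadratic_remainder (fun z => (p * (z - RtoC rho) + q)%C) s p 0 1);
      [lra |].
    intros h _. replace (_ - _ - _)%C with (RtoC 0) by ring. rewrite Cmod_0. lra. }
  pose proof (is_derive_comp (K := C_AbsRing) (V := C_NormedModule) Cinv
    (fun z => (Ci * RtoC c * (z - RtoC rho) + RtoC d)%C) s _ _ (Cinv_derive _ Hnz)
    (proj1 (is_derive_C_AbsRing _ _ _) (Haff _ _))) as H1.
  pose proof (is_derive_mult (K := C_AbsRing) _ _ s _ _
    (proj1 (is_derive_C_AbsRing _ _ _) (Haff (RtoC a) (- (Ci * RtoC b))%C))
    (proj1 (is_derive_C_AbsRing _ _ _) H1) Cmult_comm) as H2.
  pose proof (is_derive_plus (K := C_AbsRing) (V := C_NormedModule) _ _ s _ _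
    (proj2 (is_derive_C_AbsRing _ _ _) H2)
    (is_derive_const (K := C_AbsRing) (V := C_NormedModule) (RtoC rho) s)) as H3.
  eexists. exact H3.
Qed.

Lemma rank_one_PSD_on (rho : R) (k : C -> C -> C) (f : C -> C) :
  (forall s u, inH rho s -> inH rho u -> k s u = (f s * Cconj (f u))%C) -> PSD_on rho k.
Proof.
  intros H N x Hx c.
  assert (E : quad_form k N x c = RtoC (Cmod (Csum (fun i => Cconj (c i) * f (x i))%C N) ^ 2)).
  { rewrite <- Cmod_sqr_conj.
    assert (Hc : Cconj (Csum (fun i => Cconj (c i) * f (x i))%C N)
              = Csum (fun j => c j * Cconj (f (x j)))%C N).
    { clear Hx. induction N as [|N IH].
      - rewrite !Csum_0, Cmult_conj, Cconj_conj. reflexivity.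
      - rewrite !Csum_S, Cplus_conj, IH, Cmult_conj, Cconj_conj. reflexivity. }
    rewrite Hc, <- Csum_mult_r. apply Csum_eq. intros i Hi.
    rewrite <- Csum_mult_l. apply Csum_eq. intros j Hj.
    rewrite H by auto. ring. }
  rewrite E. simpl. split; [reflexivity |]. pose proof (Cmod_ge_0 (Csum (fun i => Cconj (c i) * f (x i))%C N)). nra.
Qed.

Lemma quasi_invariant_of_rank_one (rho : R) (k : C -> C -> C) :
  rank_one_dirichlet rho k -> exists J, QuasiInvariant rho (AutH rho) J k.
Proof.
  intros [b [f [Hb [Hf Hz]]]].
  pose proof (rank_one_PSD_on rho k f Hf) as HP.
  assert (Hmap : forall g s, AutH rho g -> inH rho s -> inH rho (g s)).
  { intros g s [p [q [r [d [Hdet ->]]]]] Hs. now apply inH_phiA. }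
  destruct Hz as [Hz | Hnz].
  - exists (fun _ _ => RtoC 1). split; [exact HP |]. split.
    + intros g Hg. split.
      * intros s Hs E. apply RtoC_inj in E. lra.
      * intros s Hs. eexists. apply (is_derive_const (K := C_AbsRing) (V := C_NormedModule)).
    + intros g s u Hg Hs Hu. rewrite !Hf by auto. rewrite (Hz s), (Hz (g s)) by auto. ring.
  - exists (fun g s => f s * / f (g s))%C. split; [exact HP |]. split.
    + intros g Hg. split.
      * intros s Hs. apply Cmult_neq_0; [now apply Hnz |].
        assert (Hg' : f (g s) <> RtoC 0) by (apply Hnz; auto).
        intros E. apply Hg'.
        replace (f (g s)) with (f (g s) * f (g s) * / f (g s))%C by (field; exact Hg').
        rewrite E. ring.
      * intros s Hs.
        destruct (holo_DirichletOn rho b f Hb s Hs) as [l1 H1].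
        destruct (holo_DirichletOn rho b f Hb (g s) (Hmap g s Hg Hs)) as [l2 H2].
        assert (H3 : exists l, @is_derive C_AbsRing C_NormedModule g s l).
        { destruct Hg as [p [q [r [d [Hdet ->]]]]]. now apply phiA_derive. }
        destruct H3 as [l3 H3].
        pose proof (is_derive_comp (K := C_AbsRing) (V := C_NormedModule) f g s _ _ H2
          (proj1 (is_derive_C_AbsRing _ _ _) H3)) as H4.
        pose proof (is_derive_comp (K := C_AbsRing) (V := C_NormedModule) Cinv (fun z => f (g z)) s _ _
          (Cinv_derive _ (Hnz _ (Hmap g s Hg Hs))) (proj1 (is_derive_C_AbsRing _ _ _) H4)) as H5.
        pose proof (is_derive_mult (K := C_AbsRing) _ _ s _ _
          (proj1 (is_derive_C_AbsRing _ _ _) H1) (proj1 (is_derive_C_AbsRing _ _ _) H5) Cmult_comm) as H6.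
        eexists. exact (proj2 (is_derive_C_AbsRing _ _ _) H6).
    + intros g s u Hg Hs Hu. rewrite !Hf by auto.
      assert (Hgs : f (g s) <> RtoC 0) by (apply Hnz; auto).
      assert (Hgu : f (g u) <> RtoC 0) by (apply Hnz; auto).
      rewrite Cmult_conj, Cinv_conj by exact Hgu. field.
      split; [| exact Hgs]. intros E. apply Hgu. rewrite <- (Cconj_conj (f (g u))), E. apply Cconj_RtoC.
Qed.

(** * Hilbert spaces of rank-one kernels *)

Definition rkhs_zero_or_line (rho : R) (k : C -> C -> C) : Prop :=
  PSD_on rho k /\
  forall V ip, IsRKHS rho k V ip ->
    (forall h, V h <-> h = fzero rho) \/
    (exists (b : nat -> C) (f : C -> C),
       DirichletOn rho b f /\
       (forall s, inH rho s -> f s <> RtoC 0) /\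
       (forall h, V h <-> exists c : C, h = fun x => Cmult c (f (proj1_sig x)))).

(** Since [k(., t)] is [conj (f t)] times [f], reproduction gives [h t = ip h f * f t] for every [h]
    in the space. Nonvanishing of [f] at one point puts [f] itself in the space. *)
Lemma rkhs_of_rank_one (rho : R) (k : C -> C -> C) :
  rank_one_dirichlet rho k -> rkhs_zero_or_line rho k.
Proof.
  intros [b [f [Hb [Hf Hz]]]]. split; [now apply (rank_one_PSD_on rho k f) |].
  intros V ip [V0 [Vadd [Vscal [ipadd [ipscal [ipsym [ippos [ipdef [complete [Vk repr]]]]]]]]]].
  destruct Hz as [Hz | Hnz].
  - left. intros h. split; [| now intros ->].
    intros Vh. apply functional_extensionality. intros t.
    rewrite <- (repr h t Vh).
    replace (fun x : Hr rho => k (proj1_sig x) (proj1_sig t)) with (fzero rho).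
    + assert (E : fzero rho = fscal rho (RtoC 0) (fzero rho)).
      { apply functional_extensionality. intros x. unfold fzero, fscal. ring. }
      assert (E0 : ip (fzero rho) h = RtoC 0).
      { rewrite E, ipscal by assumption. apply Cmult_0_l. }
      rewrite (ipsym (fzero rho) h V0 Vh), E0. apply Cconj_RtoC.
    + apply functional_extensionality. intros x.
      rewrite Hf, Hz by exact (proj2_sig _). unfold fzero. ring.
  - right. exists b, f. split; [exact Hb |]. split; [exact Hnz |].
    set (fr := fun x : Hr rho => f (proj1_sig x)).
    assert (Hk : forall t : Hr rho, (fun x : Hr rho => k (proj1_sig x) (proj1_sig t))
                   = fscal rho (Cconj (fr t)) fr).
    { intros t. apply functional_extensionality. intros x.
      rewrite Hf by exact (proj2_sig _). unfold fscal, fr. ring. }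
    assert (Vf : V fr).
    { assert (Ht : rho < Re (RtoC (rho + 1))) by (simpl; lra).
      set (t := exist _ _ Ht : Hr rho).
      replace fr with (fscal rho (/ Cconj (fr t)) (fscal rho (Cconj (fr t)) fr)).
      - apply Vscal. rewrite <- Hk. apply Vk.
      - apply functional_extensionality. intros x. unfold fscal. field.
        intros E. apply (Hnz _ Ht). change (fr t = RtoC 0).
        rewrite <- (Cconj_conj (fr t)), E. apply Cconj_RtoC. }
    intros h. split.
    + intros Vh. exists (ip h fr). apply functional_extensionality. intros t.
      rewrite <- (repr h t Vh), Hk.
      rewrite (ipsym _ h), ipscal, Cmult_conj, Cconj_conj, <- ipsym by auto.
      unfold fr. ring.
    + intros [c ->]. exact (Vscal c fr Vf).
Qed.

(** On a line [k(., u) = c f], and reproduction of [f] at [u] gives [f u = conj c * ip f f]. Solving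
    for [c] shows that [f / sqrt (ip f f)] is the required factor. *)
Lemma rank_one_of_rkhs (rho : R) (k : C -> C -> C) :
  rkhs_zero_or_line rho k -> rank_one_dirichlet rho k.
Proof.
  intros [HP HV].
  destruct (moore_aronszajn rho k (psd_of_PSD_on rho k HP)) as [V [ip HR]].
  pose proof (HV V ip HR) as Hcases.
  destruct HR as [V0 [Vadd [Vscal [ipadd [ipscal [ipsym [ippos [ipdef [complete [Vk repr]]]]]]]]]].
  destruct Hcases as [Hz | [b [f [Hb [Hnz Hspan]]]]].
  - exists (fun _ => RtoC 0), (fun _ => RtoC 0).
    split; [apply DirichletOn_zero |]. split; [| now left].
    intros s u Hs Hu. rewrite Cmult_0_l.
    set (x := exist _ s Hs : Hr rho). set (t := exist _ u Hu : Hr rho).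
    change (k (proj1_sig x) (proj1_sig t) = fzero rho x).
    now rewrite <- (proj1 (Hz _) (Vk t)).
  - set (fr := fun x : Hr rho => f (proj1_sig x)).
    assert (Vf : V fr).
    { apply Hspan. exists (RtoC 1). apply functional_extensionality. intros x. unfold fr. ring. }
    assert (Hreal : ip fr fr = RtoC (Re (ip fr fr))).
    { pose proof (ipsym fr fr Vf Vf) as E. destruct (ip fr fr) as [p q].
      unfold Cconj, RtoC in *; simpl in *. injection E. intros. f_equal. lra. }
    set (p := Re (ip fr fr)) in *.
    assert (Hp : 0 < p).
    { destruct (Rle_lt_or_eq_dec _ _ (ippos fr Vf)) as [H | H]; [exact H |]. fold p in H.
      exfalso. assert (Ht : rho < Re (RtoC (rho + 1))) by (simpl; lra).
      apply (Hnz _ Ht). rewrite <- H in Hreal.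
      pose proof (ipdef fr Vf Hreal) as E.
      exact (f_equal (fun h => h (exist _ _ Ht)) E). }
    assert (Hq : 0 < sqrt p) by now apply sqrt_lt_R0.
    assert (Hpc : RtoC p <> RtoC 0) by (intros X; apply RtoC_inj in X; lra).
    assert (Hs2 : (RtoC (/ sqrt p) * RtoC (/ sqrt p) = / RtoC p)%C).
    { rewrite <- RtoC_mult, <- Rinv_mult, sqrt_sqrt by lra. apply RtoC_inv. lra. }
    assert (Hk : forall s u, inH rho s -> inH rho u -> k s u = (f s * Cconj (f u) * / RtoC p)%C).
    { intros s u Hs Hu.
      set (x := exist _ s Hs : Hr rho). set (t := exist _ u Hu : Hr rho).
      destruct (proj1 (Hspan _) (Vk t)) as [c Hc].
      pose proof (repr fr t Vf) as E. rewrite Hc in E.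
      change (ip fr (fscal rho c fr) = f u) in E.
      rewrite (ipsym _ fr), ipscal, Cmult_conj, <- ipsym, Hreal in E by auto.
      assert (Hcv : c = (Cconj (f u) * / RtoC p)%C).
      { rewrite <- E, Cmult_conj, Cconj_conj, Cconj_RtoC. field. exact Hpc. }
      pose proof (f_equal (fun h => h x) Hc) as Ex. simpl in Ex. rewrite Ex, Hcv. ring. }
    exists (fun m => b m * RtoC (/ sqrt p))%C, (fun s => f s * RtoC (/ sqrt p))%C.
    split; [| split].
    + intros s Hs.
      change (filterlim (Csum (dir_term (fun m => b m * RtoC (/ sqrt p))%C s)) eventually
                (locally (f s * RtoC (/ sqrt p))%C)).
      apply filterlim_ext with (fun N => Csum (dir_term b s) N * RtoC (/ sqrt p))%C.
      * intros N. rewrite <- Csum_mult_r. apply Csum_eq. intros i _. unfold dir_term. ring.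
      * apply Clim_mult; [exact (Hb s Hs) | apply Clim_const].
    + intros s u Hs Hu. rewrite (Hk s u Hs Hu), <- Hs2, Cmult_conj, Cconj_RtoC. ring.
    + right. intros s Hs. apply Cmult_neq_0; [now apply Hnz |].
      intros E. apply RtoC_inj in E. pose proof (Rinv_0_lt_compat _ Hq). lra.
Qed.

Lemma AutLH_AutH (rho : R) (g : C -> C) : AutLH rho g -> AutH rho g.
Proof. intros [a [b [d [Hdet Hg]]]]. now exists a, b, 0, d. Qed.

Theorem theorem4p2 (rho : R) (a : nat -> nat -> C) :
  DirichletKernel rho a ->
  let k := kappa a in
  let i_ := exists J, QuasiInvariant rho (AutH rho) J k in
  let ii_ := exists J, QuasiInvariant rho (AutLH rho) J k in
  let iii_ := exists (b : nat -> C) (f : C -> C),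
      DirichletOn rho b f /\
      (forall s u, inH rho s -> inH rho u -> k s u = Cmult (f s) (Cconj (f u))) /\
      ((forall s, inH rho s -> f s = RtoC 0) \/
       (forall s, inH rho s -> f s <> RtoC 0)) in
  let iv_ := PSD_on rho k /\
      forall V ip, IsRKHS rho k V ip ->
        (forall h, V h <-> h = fzero rho) \/
        (exists (b : nat -> C) (f : C -> C),
           DirichletOn rho b f /\
           (forall s, inH rho s -> f s <> RtoC 0) /\
           (forall h, V h <-> exists c : C, h = fun x => Cmult c (f (proj1_sig x)))) in
  (i_ <-> ii_) /\ (ii_ <-> iii_) /\ (iii_ <-> iv_).
Proof.
  intros Hk k i_ ii_ iii_ iv_.
  assert (H12 : i_ -> ii_).
  { intros [J [HP [H1 H2]]]. exists J. split; [exact HP |].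
    split; intros; [apply H1 | apply H2]; auto using AutLH_AutH. }
  assert (H23 : ii_ -> iii_).
  { intros [J HJ]. exact (rank_one_of_quasi_invariant rho a J Hk HJ). }
  assert (H31 : iii_ -> i_) by exact (quasi_invariant_of_rank_one rho k).
  assert (H34 : iii_ -> iv_) by exact (rkhs_of_rank_one rho k).
  assert (H43 : iv_ -> iii_) by exact (rank_one_of_rkhs rho k).
  tauto.
Qed.
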